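(* Let $\Phi$ be an associative commutative ring with $1$ and let $A$ be a finitely generated representable PI-algebra over $\Phi$. Suppose that $A$ does not have additive torsion. Then: (a) every finitely generated subgroup of the group $\mathrm{Aut}(A)$ is virtually torsion free; (b) if $A$ is a finitely generated ring (i.e. $\Phi=\mathbb{Z}$), then the group $\mathrm{Aut}(A)$ is virtually torsion free.
   Context: Algebras are associative with $1$. An associative $\Phi$-algebra $A$ is a PI-algebra if there exist $n\ge 1$ and an element $f(x_1,\ldots,x_n)=x_1\cdots x_n+\sum_{1\ne\sigma\in S_n}\alpha_\sigma x_{\sigma(1)}\cdots x_{\sigma(n)}$, $\alpha_\sigma\in\Phi$, of the free associative algebra $\Phi\langle x_1,\ldots,x_n\rangle$ such that $f(a_1,\ldots,a_n)=0$ for all $a_1,\ldots,a_n\in A$. A PI-algebra is representable if it is embeddable in a matrix algebra $M_n(C)$ over an associative commutative algebra $C$. $\mathrm{Aut}(A)$ is the group of $\Phi$-linear algebra automorphisms of $A$. $A$ does not have additive torsion if $na=0$ with $a\in A$ and an integer $n\ge1$ implies $a=0$. A group is virtually torsion free if it has a torsion free subgroup of finite index. *)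

(* Defs.v *)
From HB Require Import structures.
From mathcomp Require Import all_boot all_order all_algebra fingroup perm.
From mathcomp Require Import boolp classical_sets cardinality.

Set Implicit Arguments.
Unset Strict Implicit.
Unset Printing Implicit Defensive.

Import GRing.Theory.
Local Open Scope classical_set_scope.
Local Open Scope ring_scope.

(* [algType] is MathComp's associative unital algebra, with 1 != 0: the zero
   algebra, whose only automorphism is the identity, is left out. *)

Section AlgebraNotions.
Variables (Phi : comPzRingType) (A : algType Phi).

Definition subalgebra (S : set A) : Prop :=
  [/\ S 1,
      forall (k : Phi) x y, S x -> S y -> S (k *: x + y)
    & forall x y, S x -> S y -> S (x * y)].

Definition finitely_generated_algebra : Prop :=
  exists s : seq A, smallest subalgebra [set` s] = [set: A].

(* The element f of the free algebra is given by its coefficients alpha; it is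
   evaluated at a_0, ..., a_(n-1).  The products are in increasing order of the
   position i. *)
Definition PI_algebra : Prop :=
  exists2 n : nat, (0 < n)%N &
  exists alpha : 'S_n -> Phi, forall a : 'I_n -> A,
    \prod_(i < n) a i
    + \sum_(s : 'S_n | s != 1%g) alpha s *: \prod_(i < n) a (s i) = 0.

(* The embedding is a unital homomorphism of Phi-algebras: k in Phi acts on
   M_n(C) as multiplication by its image k%:A in C. *)
Definition representable : Prop :=
  exists (C : comAlgType Phi) (n : nat) (f : {rmorphism A -> 'M[C]_n}),
    [/\ (0 < n)%N, injective f
      & forall (k : Phi) (x : A), f (k *: x) = k%:A *: f x].

Definition no_additive_torsion : Prop :=
  forall (n : nat) (a : A), (0 < n)%N -> a *+ n = 0 -> a = 0.

End AlgebraNotions.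

Section Automorphisms.
Variables (Phi : comPzRingType) (A : algType Phi).

Definition is_automorphism (f : A -> A) : Prop :=
  [/\ bijective f, {morph f : x y / x + y}, monoid_morphism f & scalable f].

Record algAut : Type := AlgAut {
  algAut_fun :> A -> A;
  algAutP : is_automorphism algAut_fun
}.

Lemma autE (f g : algAut) : f =1 g -> f = g.
Proof.
case: f g => [f fP] [g gP] /= /funext efg.
by move: fP gP; rewrite efg => fP gP; congr AlgAut; apply: Prop_irrelevance.
Qed.

Lemma is_automorphism_id : is_automorphism id.
Proof. by split=> //; exists id. Qed.

Lemma is_automorphism_comp (f g : algAut) : is_automorphism (f \o g).
Proof.
case: f g => [f [bf fD [f1 fM] fZ]] [g [bg gD [g1 gM] gZ]] /=; split.
- exact: bij_comp.
- by move=> x y /=; rewrite gD fD.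
- by split=> [|x y] /=; rewrite ?g1 ?f1 // gM fM.
- by move=> k x /=; rewrite gZ fZ.
Qed.

Lemma aut_has_inv (f : algAut) :
  exists g : A -> A, [/\ cancel f g, cancel g f & is_automorphism g].
Proof.
case: f => [f [[g fK gK] fD [f1 fM] fZ]] /=; exists g; split=> //; split.
- by exists f.
- by move=> x y; apply: (can_inj fK); rewrite fD !gK.
- split=> [|x y]; apply: (can_inj fK); first by rewrite gK f1.
  by rewrite fM !gK.
- by move=> k x; apply: (can_inj fK); rewrite fZ !gK.
Qed.

Definition aut_one : algAut := AlgAut is_automorphism_id.
Definition aut_mul (f g : algAut) : algAut := AlgAut (is_automorphism_comp f g).
Definition aut_inv (f : algAut) : algAut :=
  let: exist g gP := cid (aut_has_inv f) in
  AlgAut (let: And3 _ _ h := gP in h).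

Lemma aut_invK (f : algAut) : cancel f (aut_inv f).
Proof. by rewrite /aut_inv; case: cid => g [] /=. Qed.

Lemma autK_inv (f : algAut) : cancel (aut_inv f) f.
Proof. by rewrite /aut_inv; case: cid => g [] /=. Qed.

Fact aut_mulA : associative aut_mul. Proof. by move=> f g h; apply: autE. Qed.
Fact aut_mul1g : left_id aut_one aut_mul. Proof. by move=> f; apply: autE. Qed.
Fact aut_mulg1 : right_id aut_one aut_mul. Proof. by move=> f; apply: autE. Qed.
Fact aut_mulVg : left_inverse aut_one aut_inv aut_mul.
Proof. by move=> f; apply: autE => x /=; apply: aut_invK. Qed.
Fact aut_mulgV : right_inverse aut_one aut_inv aut_mul.
Proof. by move=> f; apply: autE => x /=; apply: autK_inv. Qed.

HB.instance Definition _ := gen_eqMixin algAut.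
HB.instance Definition _ := gen_choiceMixin algAut.
HB.instance Definition _ :=
  isGroup.Build algAut aut_mulA aut_mul1g aut_mulg1 aut_mulVg aut_mulgV.

End Automorphisms.

Section GroupNotions.
Local Open Scope group_scope.
Variable G : groupType.

Definition subgroup (H : set G) : Prop :=
  [/\ H 1, forall x y, H x -> H y -> H (x * y) & forall x, H x -> H x^-1].

Definition finitely_generated_subgroup (H : set G) : Prop :=
  exists s : seq G, H = smallest subgroup [set` s].

Definition torsion_free (K : set G) : Prop :=
  forall (x : G) (n : nat), K x -> (0 < n)%N -> x ^+ n = 1 -> x = 1.

Definition finite_index (H K : set G) : Prop :=
  finite_set [set [set x * k | k in K] | x in H].

Definition virtually_torsion_free (H : set G) : Prop :=
  exists K : set G,
    [/\ subgroup K, K `<=` H, finite_index H K & torsion_free K].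

End GroupNotions.

(* Main.v *)
From HB Require Import structures.
Require Import Defs.
From mathcomp Require Import all_boot all_order all_algebra.
From mathcomp Require Import boolp classical_sets cardinality.
From mathcomp Require Import ring zify.

(** Let [A0] be a finitely generated subring of [A] preserved by a group [H] of
    automorphisms acting faithfully on it. The algebra [A] embeds in the
    matrices of size [n] over a commutative ring, so [A0] is realised by
    matrices over a finitely generated commutative ring [R], which is
    noetherian. It is enough to find a torsion free subgroup of finite index of
    such an [H]: in part (b) one takes [A0] to be [A], and in part (a) the ring
    generated by the generators of [A] together with the finitely many scalars
    needed to express the action of the generators of [H] and their inverses.

    Consider a homomorphism [psi] from [R] to a finite domain [D], and the
    automorphisms that do not change any representation of [A0] by matrices of
    size [2n] over [D]. There are finitely many such representations, so these
    automorphisms form a subgroup of finite index. Let [h] be one of them, of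
    prime order [p] with [p] nonzero in [D], and let [X] be the ideal of [R]
    generated by all entries of the matrices [f (h a) - f a], where [f] is the
    given realisation. If [X] were larger than [ker psi * X], a functional
    [lambda] on the quotient would give a derivation
    [delta a = lambda (f (h a) - f a)] along [psi \o f], hence a block
    triangular representation of size [2n]. As [h] does not change it, [delta]
    is invariant under [h], and summing over the orbit of [a] gives
    [0 = lambda (f (iter p h a) - f a) = p * delta a]; so [delta] and [lambda]
    would vanish. Thus [X = ker psi * X], and by Nakayama's lemma some [u]
    outside [ker psi] annihilates [X] ([invisible_displacement]).

    To conclude that [X] is a torsion ideal, finitely many [psi] are chosen
    such that, for every [p] and every non-torsion element [x] of [R], the
    elements [u] with [u * x] zero all lie in the kernel of one of them, with [p]
    nonzero in its target ([detecting_points]). By noetherian induction the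
    annihilators of non-torsion elements modulo torsion lie in finitely many
    proper ideals [P] that contain no nonzero integer, and each [P] lies in the
    kernels of two homomorphisms to finite domains of different
    characteristics. These exist because a finitely generated domain that
    becomes a field by inverting one element is finite ([goldman_finite]). As
    [A] has no additive torsion and [X] is torsion, [h] is the identity. *)

Set Implicit Arguments.
Unset Strict Implicit.
Unset Printing Implicit Defensive.

Import Order.TTheory GRing.Theory Num.Theory.
Local Open Scope classical_set_scope.
Local Open Scope ring_scope.

(** * Subrings and rings generated by finitely many elements *)

Definition subring (R : pzRingType) (S : set R) : Prop :=
  [/\ S 1, forall x y, S x -> S y -> S (x - y)
    & forall x y, S x -> S y -> S (x * y)].

Lemma subring0 (R : pzRingType) (S : set R) : subring S -> S 0.
Proof. by case=> S1 SB _; rewrite -(subrr (1 : R)); apply: SB. Qed.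

Lemma subringN (R : pzRingType) (S : set R) x : subring S -> S x -> S (- x).
Proof.
move=> Ss Sx; case: (Ss) => _ SB _; rewrite -sub0r.
by apply: SB => //; apply: subring0.
Qed.

Lemma subringD (R : pzRingType) (S : set R) x y :
  subring S -> S x -> S y -> S (x + y).
Proof.
move=> Ss Sx Sy; case: (Ss) => _ SB _; rewrite -[y]opprK.
by apply: SB => //; apply: subringN.
Qed.

Local Notation subring_gen s := (smallest (@subring _) [set` s]).

Lemma generated_subring (R : pzRingType) (s : seq R) : subring (subring_gen s).
Proof.
split=> [T [[]]//|x y Sx Sy T [Ts sT]|x y Sx Sy T [Ts sT]].
  by case: (Ts) => _ TB _; apply: TB; [apply: Sx|apply: Sy].
by case: (Ts) => _ _ TM; apply: TM; [apply: Sx|apply: Sy].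
Qed.

(** The base [R] varies, so that generators can be absorbed one at a time by
    passing from [R] to [{poly R}]. *)
Definition generated_over (R D : pzRingType) (iota : R -> D) (s : seq D) :=
  forall S : set D, subring S -> (forall x, S (iota x)) ->
    (forall x, x \in s -> S x) -> forall x, S x.

Section PolynomialTower.
Variables (R D : comNzRingType) (iota : {rmorphism R -> D}) (y : D).

Definition evaluation : {poly R} -> D :=
  horner_morph (fun x => mulrC y (iota x)).

HB.instance Definition _ := GRing.RMorphism.on evaluation.

Lemma evaluationE p : evaluation p = (map_poly iota p).[y].
Proof. by []. Qed.

Lemma evaluationC c : evaluation c%:P = iota c.
Proof. exact: horner_morphC. Qed.

Lemma evaluationX : evaluation 'X = y.
Proof. exact: horner_morphX. Qed.

Lemma generated_over_evaluation s :
  generated_over iota (y :: s) -> generated_over evaluation s.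
Proof.
move=> gen S Ss Se Sgen; apply: gen => // [x|x].
  by rewrite -evaluationC.
by rewrite inE => /predU1P[->|/Sgen//]; rewrite -evaluationX.
Qed.

End PolynomialTower.

Lemma generated_over_nil (R D : comNzRingType) (iota : {rmorphism R -> D}) d :
  generated_over iota [::] -> exists x, iota x = d.
Proof.
move=> gen; apply: (gen [set z | exists x, iota x = z]) => [|x|//]; last first.
  by exists x.
split=> [|_ _ [x <-] [z <-]|_ _ [x <-] [z <-]].
- by exists 1; rewrite rmorph1.
- by exists (x - z); rewrite rmorphB.
- by exists (x * z); rewrite rmorphM.
Qed.

(** * Ideals and the ascending chain condition *)

Definition ideal (R : comNzRingType) (I : set R) : Prop :=
  [/\ I 0, forall x y, I x -> I y -> I (x + y)
    & forall c x, I x -> I (c * x)].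

Lemma idealN (R : comNzRingType) (I : set R) x : ideal I -> I x -> I (- x).
Proof. by case=> _ _ IM Ix; rewrite -mulN1r; apply: IM. Qed.

Lemma idealB (R : comNzRingType) (I : set R) x y :
  ideal I -> I x -> I y -> I (x - y).
Proof. by move=> Ii Ix Iy; case: (Ii) => _ ID _; apply: ID => //; apply: idealN. Qed.

Definition ideal_add (R : comNzRingType) (I : set R) (b : R) : set R :=
  [set x | exists c, I (x - c * b)].

Lemma ideal_add_ideal (R : comNzRingType) (I : set R) b :
  ideal I -> ideal (ideal_add I b).
Proof.
move=> Ii; case: (Ii) => I0 ID IM; split.
- by exists 0; rewrite mul0r subrr.
- move=> x y [c Ic] [d Id]; exists (c + d).
  by rewrite mulrDl opprD addrACA; apply: ID.
- by move=> e x [c Ic]; exists (e * c); rewrite -mulrA -mulrBr; apply: IM.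
Qed.

Lemma sub_ideal_add (R : comNzRingType) (I : set R) b : I `<=` ideal_add I b.
Proof. by move=> x Ix; exists 0; rewrite mul0r subr0. Qed.

Lemma ideal_add_gen (R : comNzRingType) (I : set R) b :
  ideal I -> ideal_add I b b.
Proof. by case=> I0 _ _; exists 1; rewrite mul1r subrr. Qed.

Definition noetherian (R : comNzRingType) : Prop :=
  forall I : nat -> set R, (forall n, ideal (I n)) ->
    (forall n, I n `<=` I n.+1) -> exists n, forall m, I m `<=` I n.

Lemma chain_le (T : Type) (I : nat -> set T) m n :
  (forall n, I n `<=` I n.+1) -> (m <= n)%N -> I m `<=` I n.
Proof.
move=> Imono /subnK <-; elim: (n - m)%N => [|k IHk] // x Ix.
by rewrite addSn; apply/Imono/IHk.
Qed.

(** A property of ideals without a maximal witness would, by dependent choice,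
    produce a strictly increasing chain. *)
Lemma noetherian_max (R : comNzRingType) (Q : set R -> Prop) I0 :
  noetherian R -> ideal I0 -> Q I0 ->
  exists I, [/\ ideal I, Q I & forall J, ideal J -> Q J -> I `<=` J -> J = I].
Proof.
move=> noeth idI0 QI0; apply: contrapT => noMax.
have step I : exists J, ideal I /\ Q I ->
    [/\ ideal J, Q J, I `<=` J & ~ (J `<=` I)].
  have [[idI QI]|] := pselect (ideal I /\ Q I); last by exists I.
  apply: contrapT => noJ; apply: noMax; exists I; split=> // J idJ QJ IJ.
  apply/seteqP; split=> //; apply: contrapT => JI.
  by apply: noJ; exists J.
pose next I := sval (cid (step I)).
have nextP I : ideal I /\ Q I ->
    [/\ ideal (next I), Q (next I), I `<=` next I & ~ (next I `<=` I)].
  exact: (svalP (cid (step I))).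
pose I n := iter n next I0.
have good n : ideal (I n) /\ Q (I n).
  by elim: n => [|n /nextP[]].
have [|n nP|n stable] := noeth I; first by move=> n; case: (good n).
  by have [_ _ + _] := nextP _ (good n); apply.
by have [_ _ _ []] := nextP _ (good n); apply: stable n.+1.
Qed.

Lemma noetherian_ind (R : comNzRingType) (Q G : set R -> Prop) :
  noetherian R ->
  (forall I, ideal I -> Q I ->
     (forall J, ideal J -> Q J -> I `<=` J -> J <> I -> G J) -> G I) ->
  forall I, ideal I -> Q I -> G I.
Proof.
move=> noeth ind I idI QI; apply: contrapT => nG.
have [J [idJ [QJ nGJ] Jmax]] :=
  @noetherian_max R (fun I => Q I /\ ~ G I) I noeth idI (conj QI nG).
apply: nGJ; apply: ind => // K idK QK JK KJ; apply: contrapT => nGK.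
exact/KJ/Jmax.
Qed.

(** In a chain the union of all ideals is the principal ideal of an integer of
    least absolute value, and that integer already lies in some term. *)
Lemma noetherian_int : noetherian int.
Proof.
move=> I idI Imono.
have [[k [k0 [n Ink]]]|none] := pselect (exists k : nat, (0 < k)%N /\
    exists n, I n k%:Z); last first.
  exists 0%N => m x Imx; have [->|x0] := eqVneq x 0; first by case: (idI 0%N).
  case: none; exists `|x|%N; rewrite absz_gt0; split=> //; exists m.
  case: x Imx x0 => [x|x] // Imx _; rewrite /= -[x.+1%:Z]opprK -NegzE.
  exact: idealN.
pose P k := `[< (0 < k)%N /\ exists n, I n k%:Z >].
have exP : exists k, P k by exists k; apply/asboolP; split=> //; exists n.
case: (ex_minnP exP) => {n Ink} d /asboolP[d0 [n Ind]] dmin.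
exists n => m x Imx.
have [_ _ IM] := idI n.
rewrite (divz_eq x d); suff -> : (x %% d)%Z = 0 by rewrite addr0; apply: IM.
apply/eqP; rewrite eq_le modz_ge0 ?andbT; last by rewrite eqz_nat -lt0n.
rewrite leNgt; apply/negP => r0.
pose k' := `|(x %% d)%Z|%N.
have k'E : k'%:Z = (x %% d)%Z by rewrite /k' gez0_abs ?ltW.
have : (d <= k')%N.
  apply: dmin; apply/asboolP; split; first by rewrite absz_gt0 gt_eqF.
  exists (maxn n m); rewrite k'E /modz; apply: idealB => //.
    exact: chain_le (leq_maxr n m) _ Imx.
  have [_ _ IM'] := idI (maxn n m).
  by apply: IM'; apply: chain_le (leq_maxl n m) _ Ind.
by rewrite leqNgt -ltz_nat k'E ltz_pmod.
Qed.

Lemma noetherian_surj (R D : comNzRingType) (iota : {rmorphism R -> D}) :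
  (forall d, exists x, iota x = d) -> noetherian R -> noetherian D.
Proof.
move=> surj noeth I idI Imono.
have [|n x|n stable] := noeth (fun n => iota @^-1` I n).
- move=> n; case: (idI n) => I0 ID IM; split=> [|x y|c x] /=.
  + by rewrite rmorph0.
  + by rewrite rmorphD; apply: ID.
  + by rewrite rmorphM; apply: IM.
- exact: Imono.
exists n => m d; have [x <-] := surj d; exact: stable.
Qed.

Section HilbertBasis.
Variable R : comNzRingType.

(** Members of degree below [n] count, with coefficient zero, so that this is an
    ideal and increases with [n]. *)
Definition lead_ideal (I : set {poly R}) (n : nat) : set R :=
  [set c | exists p, [/\ I p, (size p <= n.+1)%N & p`_n = c]].

Lemma lead_ideal_ideal I n : ideal I -> ideal (lead_ideal I n).
Proof.
case=> I0 ID IM; split=> [|_ _ [p [Ip sp <-]] [q [Iq sq <-]]|c _ [p [Ip sp <-]]].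
- by exists 0; rewrite size_poly0 coef0.
- exists (p + q); split; [exact: ID| |by rewrite coefD].
  by rewrite (leq_trans (size_polyD _ _)) // geq_max sp.
- exists (c%:P * p); split; [exact: IM| |by rewrite coefCM].
  by rewrite mul_polyC (leq_trans (size_scale_leq _ _)).
Qed.

Lemma lead_idealS (I : set {poly R}) n : ideal I ->
  lead_ideal I n `<=` lead_ideal I n.+1.
Proof.
case=> _ _ IM _ [p [Ip sp <-]]; exists ('X * p); split; first exact: IM.
  have [->|p0] := eqVneq p 0; first by rewrite mulr0 size_poly0.
  by rewrite mulrC size_mulX.
by rewrite mulrC coefMX.
Qed.

Lemma lead_ideal_sub (I J : set {poly R}) n : I `<=` J ->
  lead_ideal I n `<=` lead_ideal J n.
Proof. by move=> IJ _ [p [/IJ Jp sp <-]]; exists p. Qed.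

(** Cancel leading terms: the difference of two members with the same leading
    coefficient has smaller size. *)
Lemma lead_ideal_eq (I J : set {poly R}) : ideal I -> ideal J -> I `<=` J ->
  (forall n, lead_ideal J n `<=` lead_ideal I n) -> J `<=` I.
Proof.
move=> idI idJ IJ lJI p Jp; have [n] := ubnP (size p).
elim: n p Jp => // n IHn p Jp /[1!ltnS] sp.
have [q [Iq sq qn]] : lead_ideal I n p`_n.
  by apply: lJI; exists p; split=> //; apply: leqW.
case: n IHn sp sq qn => [|n] IHn sp sq qn.
  by move: sp; rewrite leqn0 size_poly_eq0 => /eqP->; case: idI.
have [r [Ir sr rn]] : lead_ideal I n p`_n by apply: lJI; exists p.
rewrite -(subrK r p); case: (idI) => _ ID _; apply: ID => //.
apply: IHn; first by apply: idealB => //; apply: IJ.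
rewrite ltnS; apply/leq_sizeP => j; rewrite leq_eqVlt coefB.
case: eqP => [<- _|_ /= ltnj]; first by rewrite rn subrr.
by rewrite !nth_default ?subrr ?(leq_trans sp) ?(leq_trans sr).
Qed.

(** Along a chain of ideals the leading ideals form a double sequence,
    increasing in both indices. Its diagonal stabilises, say at [k]; this
    controls all degrees from [k] on, and the finitely many smaller degrees
    stabilise separately. *)
Theorem noetherian_poly : noetherian R -> noetherian {poly R}.
Proof.
move=> noeth I idI Imono.
have idL m n : ideal (lead_ideal (I m) n) by apply/lead_ideal_ideal/idI.
have mono m n i j : (m <= i)%N -> (n <= j)%N ->
    lead_ideal (I m) n `<=` lead_ideal (I i) j.
  move=> mi nj c /(lead_ideal_sub (chain_le Imono mi)).
  by apply: (@chain_le _ (lead_ideal (I i)) n j) => // l; apply/lead_idealS/idI.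
have [|k kP] := noeth (fun n => lead_ideal (I n) n) (fun n => idL n n).
  by move=> n; apply: mono.
have [M MP] : exists M, forall n m, (n < k)%N ->
    lead_ideal (I m) n `<=` lead_ideal (I M) n.
  elim: {kP} k => [|k [M MP]]; first by exists 0%N.
  have [|N NP] := noeth (fun m => lead_ideal (I m) k) (fun m => idL m k).
    by move=> m; apply: mono.
  exists (maxn M N) => n m; rewrite ltnS leq_eqVlt => /predU1P[->|nk].
    by move=> c /NP; apply: mono; rewrite ?leq_maxr.
  by move=> c /(MP _ _ nk); apply: mono; rewrite ?leq_maxl.
exists (maxn M k) => m; pose N := maxn m (maxn M k).
suff : I N `<=` I (maxn M k).
  by move=> sub x Ix; apply: sub; apply: chain_le Ix => //; apply: leq_maxl.
apply: lead_ideal_eq => //; first by apply: chain_le; rewrite // leq_maxr.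
move=> n c; have [nk|kn] := ltnP n k.
  by move=> /(MP _ _ nk); apply: mono; rewrite ?leq_maxl.
move=> /(@mono _ _ (maxn N n) (maxn N n) (leq_maxl _ _) (leq_maxr _ _)) /kP.
by apply: mono => //; apply: leq_maxr.
Qed.

End HilbertBasis.

Lemma noetherian_generated_over (R D : comNzRingType)
    (iota : {rmorphism R -> D}) (s : seq D) :
  generated_over iota s -> noetherian R -> noetherian D.
Proof.
elim: s R iota => [|y s IHs] R iota gen noeth.
  by apply: noetherian_surj noeth => d; apply: generated_over_nil gen.
by apply: IHs (generated_over_evaluation gen) _; apply: noetherian_poly.
Qed.

Definition finitely_generated_ring (D : comNzRingType) : Prop :=
  exists s : seq D, generated_over (intr : int -> D) s.

Lemma noetherian_fg (D : comNzRingType) :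
  finitely_generated_ring D -> noetherian D.
Proof. by case=> s gen; apply: noetherian_generated_over gen noetherian_int. Qed.

(** * Finitely generated domains that become fields by inverting one element *)

(** Goldman's condition on a domain, here the image of [iota]: inverting the
    single element [a] turns it into a field. *)
Definition goldman (R : comNzRingType) (D : idomainType) (iota : R -> D) :=
  exists a, iota a != 0 /\
    forall b, iota b != 0 -> exists c k, iota (b * c) = iota (a ^+ k).

Lemma exp_sub1_mod (R : comNzRingType) (b : R) k :
  exists g, (b - 1) ^+ k = b * g + (- 1) ^+ k.
Proof.
elim: k => [|k [g IHk]]; first by exists 0; rewrite !expr0 mulr0 add0r.
exists ((b - 1) * g + (- 1) ^+ k).
by rewrite exprS IHk [in RHS]exprS; ring.
Qed.

Section GoldmanDescent.
Variables (R : comNzRingType) (D : idomainType) (iota : {rmorphism R -> D}).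
Variable y : D.
Local Notation ev := (evaluation iota y).

(** If [y] were transcendental, [1 + 'X * a] would divide a power of [a]; being
    coprime to [a], it would be a unit, although its degree is positive. *)
Lemma goldman_algebraic : goldman ev ->
  exists f : {poly R}, map_poly iota f != 0 /\ ev f = 0.
Proof.
case=> a [a0 aP]; apply: contrapT => noalg.
have transc f : ev f = 0 -> map_poly iota f = 0.
  by move=> fy; apply: contrapT => /eqP f0; apply: noalg; exists f.
pose b : {poly R} := 'X * a + 1.
pose a' := map_poly iota a; pose b' := map_poly iota b.
have b'E : b' = 'X * a' + 1 by rewrite /b' rmorphD rmorphM rmorph1 /= map_polyX.
have a'0 : a' != 0.
  by apply: contra_neq a0 => a'0; rewrite evaluationE [map_poly _ _]a'0 horner0.
have size_b' : (size b' = (size a').+1)%N.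
  rewrite b'E mulrC size_polyDl ?size_mulX // size_poly1 ltnS.
  by rewrite size_poly_gt0.
have b0 : ev b != 0.
  apply: contra_eq_neq size_b' => /transc.
  by rewrite -/b' => ->; rewrite size_poly0.
have [c [k /eqP]] := aP b b0.
rewrite -subr_eq0 -rmorphB => /eqP/transc/eqP.
rewrite rmorphB subr_eq0 rmorphM rmorphXn /= -/a' -/b' => /eqP bc.
have [g gP] := exp_sub1_mod b' k.
have b'unit : b' \is a GRing.unit.
  apply/unitrPr; exists ((map_poly iota c * 'X ^+ k - g) * (-1) ^+ k).
  rewrite mulrA mulrBr mulrA bc.
  have -> : a' ^+ k * 'X ^+ k = b' * g + (-1) ^+ k.
    by rewrite -exprMn -gP b'E addrK mulrC.
  by rewrite addrAC subrr add0r -expr2 sqrr_sign.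
move: b'unit; rewrite poly_unitE size_b' eqSS size_poly_eq0.
by rewrite (negPf a'0).
Qed.

(** A vanishing polynomial whose image is nonzero may be shortened until the
    image of its leading coefficient is nonzero. *)
Lemma algebraic_lead (f : {poly R}) : map_poly iota f != 0 -> ev f = 0 ->
  exists g, iota (lead_coef g) != 0 /\ ev g = 0.
Proof.
have [n] := ubnP (size f); elim: n f => // n IHn f /[1!ltnS] sf f0 fy.
have [l0|] := eqVneq (iota (lead_coef f)) 0; last by exists f.
case: n IHn sf => [|n] IHn sf.
  by move: sf f0; rewrite leqn0 size_poly_eq0 => /eqP->; rewrite rmorph0 eqxx.
pose g := f - lead_coef f *: 'X^((size f).-1).
have gf : map_poly iota g = map_poly iota f.
  by rewrite rmorphB /= map_polyZ /= l0 scale0r subr0.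
have f0' : f != 0 by apply: contra_neq f0 => ->; rewrite rmorph0.
apply: (IHn g); rewrite ?gf ?evaluationE ?gf //.
rewrite ltnS; apply/leq_sizeP => j; rewrite coefB coefZ coefXn.
case: (ltngtP j (size f).-1) => [jf|fj|->] nj /=.
- have: (j < n)%N by rewrite (leq_trans jf) // -ltnS prednK ?size_poly_gt0.
  by rewrite ltnNge nj.
- rewrite mulr0 subr0 nth_default //.
  by rewrite -[size f]prednK // size_poly_gt0.
- by rewrite mulr1 subrr.
Qed.

(** Homogenising a monic equation satisfied by [z = t / b] and clearing
    denominators shows that [b] divides a power of [t]. *)
Lemma homogenised_horner (b t : R) (z : D) (g : {poly R}) d :
  iota b * z = iota t -> (size g <= d.+1)%N ->
  exists c, iota b ^+ d * (map_poly iota g).[z]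
            = iota (g`_d * t ^+ d + b * c).
Proof.
move=> bz; elim: d g => [|d IHd] g.
  move=> /size1_polyC->; exists 0.
  by rewrite map_polyC hornerC coefC eqxx !expr0 mulr0 addr0 mulr1 mul1r.
elim/poly_ind: g => [|g c _] sg.
  by exists 0; rewrite rmorph0 horner0 coef0 mul0r !mulr0 addr0 rmorph0.
have {}sg : (size g <= d.+1)%N.
  move: sg; rewrite size_MXaddC; case: ifP => [/andP[/eqP->]|_]; last by [].
  by rewrite size_poly0.
have [e eP] := IHd g sg.
exists (e * t + b ^+ d * c).
rewrite rmorphD rmorphM /= map_polyX map_polyC hornerMXaddC /=.
rewrite coefD coefMX coefC /= addr0.
have -> : iota b ^+ d.+1 * ((map_poly iota g).[z] * z + iota c) =
    (iota b ^+ d * (map_poly iota g).[z]) * (iota b * z) + iota b ^+ d.+1 * iota c.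
  by rewrite exprS; ring.
by rewrite eP bz !(exprS, rmorphD, rmorphM, rmorphXn); ring.
Qed.

Section AlgebraicStep.
Variable f : {poly R}.
Hypotheses (f_lead : iota (lead_coef f) != 0) (fy : ev f = 0).
Local Notation r0 := (lead_coef f).

Lemma pseudo_remainder g : exists k (r : {poly R}),
  (size r < size f)%N /\ iota r0 ^+ k * ev g = ev r.
Proof.
have [n] := ubnP (size g); elim: n g => // n IHn g /[1!ltnS] sg.
have [gf|fg] := ltnP (size g) (size f).
  by exists 0%N, g; rewrite expr0 mul1r.
have f0 : (0 < size f)%N.
  rewrite size_poly_gt0; apply: contra_neq f_lead => ->.
  by rewrite lead_coef0 rmorph0.
pose h := r0 *: g - lead_coef g *: ('X^(size g - size f) * f).
have evh : ev h = iota r0 * ev g.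
  rewrite /h rmorphB /= -!mul_polyC !rmorphM /= fy !mulr0 subr0.
  by rewrite evaluationC.
have [|k [r [sr rE]]] := IHn h; last first.
  by exists k.+1, r; rewrite exprSr -mulrA -evh.
case: n {IHn} sg => [|n] sg.
  by move: (leq_trans f0 fg); rewrite ltnNge sg.
rewrite ltnS; apply/leq_sizeP => j nj; rewrite coefB !coefZ coefXnM.
have f0' := f0; have [jE|jg] := eqVneq j (size g).-1.
  have -> : (j < size g - size f)%N = false by apply/negbTE; lia.
  have -> : (j - (size g - size f) = (size f).-1)%N by lia.
  by rewrite jE -!lead_coefE mulrC subrr.
have sgj : (size g <= j)%N by lia.
rewrite [g`_j]nth_default // mulr0 sub0r.
case: ifP => jf; first by rewrite mulr0 oppr0.
have sfj : (size f <= j - (size g - size f))%N by lia.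
by rewrite [f`_(_ - _)]nth_default // mulr0 oppr0.
Qed.

Lemma char_poly_root (n : nat) (E : 'M[R]_n.+1) (v : 'cV[D]_n.+1) (z : D) :
  v ord0 ord0 != 0 -> map_mx iota E *m v = z *: v ->
  (map_poly iota (char_poly E)).[z] = 0.
Proof.
move=> v0 Ev; rewrite map_char_poly /char_poly.
set B := char_poly_mx _; have -> : (\det B).[z] = \det (map_mx (horner_eval z) B).
  by rewrite det_map_mx.
have Bv : map_mx (horner_eval z) B *m v = 0.
  have -> : map_mx (horner_eval z) B = z%:M - map_mx iota E.
    apply/matrixP => i j; rewrite !mxE /horner_eval hornerD hornerN !hornerC.
    by case: eqP; rewrite ?mulr1n ?mulr0n ?hornerX ?horner0.
  by rewrite mulmxBl mul_scalar_mx Ev subrr.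
have /(congr1 (fun M : 'cV_ _ => M ord0 ord0)) :
    \adj (map_mx (horner_eval z) B) *m (map_mx (horner_eval z) B *m v) = 0.
  by rewrite Bv mulmx0.
rewrite mulmxA mul_adj_mx mul_scalar_mx !mxE => /eqP.
by rewrite mulf_eq0 (negPf v0) orbF => /eqP.
Qed.

(** Cayley-Hamilton: multiplication by [ev g] acts on [1, y, ..., y ^+ n], up
    to powers of the leading coefficient, by a matrix over [R]. *)
Lemma integral_evaluation g : exists k (chi : {poly R}),
  chi \is monic /\ (map_poly iota chi).[iota r0 ^+ k * ev g] = 0.
Proof.
have [n sf] : exists n, size f = n.+2.
  case sf : (size f) => [|[|n]]; last by exists n.
    move/eqP: sf f_lead; rewrite size_poly_eq0 => /eqP->.
    by rewrite lead_coef0 rmorph0 eqxx.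
  have fE := size1_polyC (eq_leq sf).
  by move: f_lead fy; rewrite fE lead_coefC evaluationC => /[swap] ->; rewrite eqxx.
have /choice[k /choice[r rP]] := fun i : 'I_n.+1 => pseudo_remainder (g * 'X^i).
(* A common exponent for all rows. *)
pose K := (\sum_i k i)%N.
pose E : 'M[R]_n.+1 := \matrix_(i, j) (r0 ^+ (K - k i) * (r i)`_j).
pose v : 'cV[D]_n.+1 := \col_i y ^+ i.
exists K, (char_poly E); split; first exact: char_poly_monic.
apply: (@char_poly_root _ E v); first by rewrite mxE expr0 oner_neq0.
apply/colP => i; rewrite !mxE.
have [sr rE] := rP i.
have kK : (k i <= K)%N by rewrite /K (bigD1 i) //= leq_addr.
have -> : iota r0 ^+ K * ev g * y ^+ i = iota r0 ^+ (K - k i) * ev (r i).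
  rewrite -rE rmorphM rmorphXn /= evaluationX !mulrA; congr (_ * _ * _).
  by rewrite -exprD subnK.
rewrite evaluationE (horner_coef_wide _ (n := n.+1)); last first.
  by rewrite (leq_trans (size_poly _ _)) //; move: sr; rewrite sf ltnS.
rewrite mulr_sumr; apply: eq_bigr => j _.
by rewrite !mxE coef_map /= rmorphM rmorphXn mulrA.
Qed.

Lemma evaluation_comp (g h : {poly R}) :
  ev (g \Po h) = (map_poly iota g).[ev h].
Proof. by rewrite !evaluationE map_comp_poly horner_comp. Qed.

Lemma nonzero_constant_term (chi : {poly R}) (z : D) : z != 0 ->
  map_poly iota chi != 0 -> (map_poly iota chi).[z] = 0 ->
  exists chi1 : {poly R}, iota (chi1`_0) != 0 /\ (map_poly iota chi1).[z] = 0.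
Proof.
move=> z0; elim/poly_ind: chi => [|chi c IHchi]; first by rewrite rmorph0 eqxx.
have [c0|c0 _ chiz] := eqVneq (iota c) 0; last first.
  by exists (chi * 'X + c%:P); rewrite coefD coefMX coefC eqxx add0r.
rewrite rmorphD rmorphM /= map_polyX map_polyC /= c0 addr0 => chi0 /eqP.
rewrite hornerMX mulf_eq0 (negPf z0) orbF => /eqP; apply: IHchi.
by apply: contra_neq chi0 => ->; rewrite mul0r.
Qed.

(** In a polynomial equation for [ev a] with nonzero constant term, all the
    other terms are multiples of [ev a]. *)
Lemma nonzero_multiple a : ev a != 0 ->
  exists u c, iota c != 0 /\ ev (a * u) = iota c.
Proof.
move=> a0; have [k [chi [chimon chiz]]] := integral_evaluation a.
have z0 : iota r0 ^+ k * ev a != 0 by rewrite mulf_neq0 ?expf_neq0.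
have chi0 : map_poly iota chi != 0.
  by rewrite monic_neq0 // monic_map.
have [chi1 [chi1_0]] := nonzero_constant_term z0 chi0 chiz.
elim/poly_ind: chi1 chi1_0 => [|chi1 c _]; first by rewrite coef0 rmorph0 eqxx.
rewrite coefD coefMX coefC eqxx add0r => c0.
rewrite rmorphD rmorphM /= map_polyX map_polyC hornerMXaddC /= => chi1z.
exists (r0 ^+ k *: - (chi1 \Po (r0 ^+ k *: a))), c; split=> //.
have evZ t g : ev (t *: g) = iota t * ev g.
  by rewrite -mul_polyC rmorphM /= evaluationC.
rewrite rmorphM /= evZ rmorphN /= evaluation_comp evZ rmorphXn /=.
by apply/esym/eqP; rewrite -subr_eq0 -chi1z; apply/eqP; ring.
Qed.

(** Let [c] be a nonzero multiple of [ev a] coming from [R]. The inverse of [b]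
    exists after adjoining [y] and inverting [c]; it is integral over [R] once
    [r0] is inverted, and clearing denominators in its integral equation shows
    that it already lies in [R] with [r0] and [c] inverted. *)
Lemma goldman_descent : goldman ev -> goldman iota.
Proof.
case=> a [/nonzero_multiple[u [c [c0 auc]]] aP].
exists (r0 * c); split; first by rewrite rmorphM mulf_neq0.
move=> b b0; have [|d [k bd]] := aP b%:P; first by rewrite evaluationC.
have [M [chi [chimon chiz]]] := integral_evaluation (d * u ^+ k).
have bz : iota b * (iota r0 ^+ M * ev (d * u ^+ k)) = iota (r0 ^+ M * c ^+ k).
  have key : iota b * ev d = ev a ^+ k.
    by move: bd; rewrite rmorphM rmorphXn /= evaluationC.
  rewrite rmorphM [in RHS]rmorphM !rmorphXn /= -auc rmorphM /= exprMn -key.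
  by ring.
have [N sN] : exists N, size chi = N.+1.
  exists (size chi).-1; rewrite prednK // size_poly_gt0 monic_neq0 //.
have [e] := homogenised_horner bz (eq_leq sN).
have -> : chi`_N = 1 by rewrite -(monicP chimon) lead_coefE sN.
rewrite chiz mulr0 mul1r => /esym/eqP.
rewrite rmorphD addr_eq0 => /eqP be.
exists (- e * (r0 ^+ (k * N) * c ^+ (M * N))), ((M + k) * N)%N.
have -> : (r0 * c) ^+ ((M + k) * N) =
    (r0 ^+ M * c ^+ k) ^+ N * (r0 ^+ (k * N) * c ^+ (M * N)).
  by rewrite !exprMn -!exprM mulnDl !exprD; ring.
by rewrite [in LHS]mulrA [LHS]rmorphM [RHS]rmorphM be mulrN rmorphN.
Qed.

End AlgebraicStep.

Definition finitely_many_values (T : Type) (E : eqType) (h : T -> E) :=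
  exists e : seq E, forall x, h x \in e.

(** Two powers of [u] have the same image. *)
Lemma finite_image_inverse (u : R) : finitely_many_values iota -> iota u != 0 ->
  exists w, iota u * iota w = 1.
Proof.
case=> e eP u0; have u0' k : iota u ^+ k != 0 by rewrite expf_neq0.
pose h (k : 'I_(size e).+1) := iota (u ^+ k).
have : ~~ injectiveb h.
  apply/negP => /injectiveP hinj.
  have sub : {subset map h (enum 'I_(size e).+1) <= e}.
    by move=> _ /mapP[k _ ->]; apply: eP.
  have := uniq_leq_size _ sub.
  by rewrite map_inj_uniq // enum_uniq size_map size_enum_ord ltnn => /(_ isT).
case/injectivePn => i [j]; wlog ij : i j / (i < j)%N => [wl|].
  move=> ij hij; have [lt|lt|/val_inj E] := ltngtP i j; last by rewrite E eqxx in ij.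
    exact: (wl i j).
  by apply: (wl j i) => //; rewrite eq_sym.
move=> _; rewrite /h !rmorphXn => hij; exists (u ^+ (j - i).-1).
rewrite -rmorphM -exprS prednK ?subn_gt0 // rmorphXn /=.
apply: (mulfI (u0' i)); rewrite mulr1 -exprD subnKC //; exact: ltnW.
Qed.


Lemma finite_evaluation (f : {poly R}) : finitely_many_values iota ->
  iota (lead_coef f) != 0 -> ev f = 0 -> finitely_many_values ev.
Proof.
move=> fin lf fy; have [w lw] := finite_image_inverse fin lf.
case: (fin) => e eP.
pose value (t : {ffun 'I_(size f) -> seq_sub e}) := \sum_i val (t i) * y ^+ i.
exists (codom value) => g.
have [k [r [sr rE]]] := pseudo_remainder lf fy g.
have -> : ev g = ev (w ^+ k *: r).
  rewrite -mul_polyC rmorphM /= evaluationC -rE rmorphXn mulrA -exprMn.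
  by rewrite [iota w * _]mulrC lw expr1n mul1r.
set q := w ^+ k *: r; have sq : (size q <= size f)%N.
  by rewrite (leq_trans (size_scale_leq _ _)) // ltnW.
apply/codomP; exists [ffun i : 'I_(size f) => SeqSub (eP q`_i)].
rewrite evaluationE (horner_coef_wide _ (n := size f)); last first.
  exact: leq_trans (size_poly _ _) sq.
by apply: eq_bigr => i _; rewrite ffunE coef_map.
Qed.

End GoldmanDescent.

(** Goldman's property descends along the tower of polynomial rings, and each
    generator turns out to be algebraic over the previous stage; so finiteness
    ascends along it. *)
Lemma goldman_generated_over (D : idomainType) (s : seq D) (R : comNzRingType)
    (iota : {rmorphism R -> D}) : generated_over iota s -> goldman (@idfun D) ->
  goldman iota /\ (finitely_many_values iota -> finitely_many_values (@idfun D)).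
Proof.
move=> gen goldD; elim: s R iota gen => [|y s IHs] R iota gen.
  have surj d := @generated_over_nil _ _ _ d gen; split.
    case: goldD => a0 [a00 aP]; have [a aE] := surj a0.
    exists a; split=> [|b b0]; first by rewrite aE.
    have [c0 [k bc]] := aP _ b0; have [c cE] := surj c0.
    by exists c, k; rewrite rmorphM rmorphXn /= aE cE.
  by case=> e eP; exists e => d; have [x <-] := surj d; apply: eP.
have [goldev finev] := IHs _ _ (generated_over_evaluation gen).
have [f0 [/algebraic_lead f0P /f0P[f [lf fy]]]] := goldman_algebraic goldev.
split; first exact: goldman_descent lf fy goldev.
by move=> fin; apply: finev; apply: finite_evaluation lf fy.
Qed.

(** Euclid: no integer is divisible by all primes, so the prime ring of a
    domain with Goldman's property is finite. *)
Lemma goldman_int_finite (D : idomainType) :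
  goldman (intr : int -> D) -> finitely_many_values (intr : int -> D).
Proof.
case=> a [a0 aP].
have [[n [n0 nD]]|char0] := pselect (exists n, (0 < n)%N /\ n%:R = 0 :> D).
  exists [seq i%:R : D | i <- iota 0 n] => x.
  rewrite (divz_eq x n) rmorphD rmorphM /= -[n%:~R]/(n%:R) nD mulr0 add0r.
  have : (0 <= x %% n)%Z by rewrite modz_ge0 // eqz_nat -lt0n.
  have : (x %% n < n)%Z by rewrite ltz_pmod.
  case: (x %% n)%Z => // m mn _; apply/mapP; exists m => //.
  by rewrite mem_iota.
have inj : injective (intr : int -> D).
  move=> x y /eqP; rewrite -subr_eq0 -rmorphB /= => /eqP xy0; apply/eqP.
  rewrite -subr_eq0; apply/eqP; apply: contrapT => /eqP d0.
  apply: char0; exists `|x - y|%N; rewrite absz_gt0 d0; split=> //.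
  case: (x - y) xy0 => k //=; rewrite NegzE rmorphN /= => /eqP.
  by rewrite oppr_eq0 => /eqP.
have [p pa p_prime] := prime_above `|a|%N.
have [|c [k /inj pc]] := aP p%:Z.
  by apply/eqP => p0; apply: char0; exists p; rewrite prime_gt0.
have : (p %| `|a| ^ k)%N by rewrite -abszX -pc abszM dvdn_mulr.
have a0' : (0 < `|a|)%N.
  by rewrite absz_gt0; apply: contra_neq a0 => ->.
by rewrite Euclid_dvdX // => /andP[/(dvdn_leq a0')]; rewrite leqNgt pa.
Qed.

(** The prime ring is finite, and each generator, being algebraic over the
    finite ring before it, adds finitely many elements. *)
Theorem goldman_finite (D : idomainType) :
  finitely_generated_ring D -> goldman (@idfun D) -> finitely_many_values (@idfun D).
Proof.
case=> s gen goldD; have [goldZ] := goldman_generated_over gen goldD.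
by apply; apply: goldman_int_finite.
Qed.

(** * Homomorphisms to finite domains *)

(** Quotients are taken by boolean predicates, and a domain carries an inverse on
    its units; both are supplied classically. *)
Section PrimeQuotient.
Variables (R : comNzRingType) (P : set R).
Hypotheses (idP : ideal P) (P1 : ~ P 1).
Hypothesis P_prime : forall x y, P (x * y) -> P x \/ P y.

Definition prime_pred : R -> bool := fun x => `[< P x >].

Fact prime_pred_idealr : idealr_closed prime_pred.
Proof.
case: idP => P0 PD PM; split; first exact/asboolP.
  exact/asboolPn.
move=> a u v /asboolP Pu /asboolP Pv; apply/asboolP/PD => //; exact: PM.
Qed.

Fact prime_pred_prime : prime_idealr_closed prime_pred.
Proof.
move=> u v /asboolP/P_prime[] H; apply/orP; [left|right]; exact/asboolP.
Qed.

HB.instance Definition _ := isIdealr.Build R prime_pred prime_pred_idealr.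
HB.instance Definition _ :=
  isPrimeIdealrClosed.Build R prime_pred prime_pred_prime.

Definition prime_pred_ideal : prime_idealr R := prime_pred.

Definition prime_quotient := {ideal_quot prime_pred_ideal}.
HB.instance Definition _ := GRing.ComNzRing.on prime_quotient.

Definition quotient_unit : pred prime_quotient :=
  fun x => `[< exists y, y * x = 1 >].
Definition quotient_inv (x : prime_quotient) : prime_quotient :=
  if pselect (exists y, y * x = 1) is left ex then sval (cid ex) else x.

Fact quotient_mulVx : {in quotient_unit, left_inverse 1 quotient_inv *%R}.
Proof.
move=> x /asboolP ex; rewrite /quotient_inv; case: pselect => // ex'.
exact: svalP (cid ex').
Qed.

Fact quotient_unitPl (x y : prime_quotient) : y * x = 1 -> quotient_unit x.
Proof. by move=> yx; apply/asboolP; exists y. Qed.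

Fact quotient_inv_out : {in [predC quotient_unit], quotient_inv =1 id}.
Proof.
move=> x /asboolPn nex; rewrite /quotient_inv.
by case: pselect.
Qed.

HB.instance Definition _ := GRing.ComNzRing_hasMulInverse.Build prime_quotient
  quotient_mulVx quotient_unitPl quotient_inv_out.
HB.instance Definition _ := GRing.ComUnitRing_isIntegral.Build prime_quotient
  (@Quotient.rquot_IdomainAxiom _ prime_pred_ideal).

Lemma prime_idealP : exists (D : idomainType) (psi : {rmorphism R -> D}),
  (forall d, exists x, psi x = d) /\ (forall x, psi x = 0 <-> P x).
Proof.
pose psi : {rmorphism R -> prime_quotient} := \pi_(prime_quotient)%qT.
exists prime_quotient, psi; split=> [d|x].
  by exists (repr d); rewrite /psi /= reprK.
rewrite -(rmorph0 psi); split=> [psix|Px].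
  have := Quotient.idealrBE prime_pred_ideal x 0.
  by rewrite subr0 [RHS](introT eqP psix) => /asboolP.
apply/eqP; have := Quotient.idealrBE prime_pred_ideal x 0.
by rewrite subr0 => <-; apply/asboolP.
Qed.

End PrimeQuotient.

(** An ideal maximal among those avoiding all powers of [b] is prime, and its
    quotient has Goldman's property with respect to [b]. *)
Theorem finite_domain_avoiding (R : comNzRingType) (P : set R) (b : R) :
  finitely_generated_ring R -> ideal P -> (forall k, ~ P (b ^+ k)) ->
  exists (D : idomainType) (psi : {rmorphism R -> D}),
    [/\ finitely_many_values (@idfun D), forall x, P x -> psi x = 0 & psi b != 0].
Proof.
move=> fg idP Pb.
have [M [idM [PM Mb] Mmax]] := @noetherian_max R
  (fun I => P `<=` I /\ forall k, ~ I (b ^+ k)) P (noetherian_fg fg) idP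
  (conj (@subset_refl _ P) Pb).
have [M0 MD MM] := idM.
have meets x : ~ M x -> exists c k, M (b ^+ k - c * x).
  move=> Mx; apply: contrapT => none; apply: Mx.
  rewrite -(Mmax (ideal_add M x)); first exact: ideal_add_gen.
  - exact: ideal_add_ideal.
  - split=> [y /PM My|k [c Mc]]; first exact: sub_ideal_add.
    by apply: none; exists c, k.
  - exact: sub_ideal_add.
have M1 : ~ M 1 by have := Mb 0%N; rewrite expr0.
have [|D [psi [surj ker]]] := prime_idealP idM M1.
  move=> x y Mxy; apply: contrapT => /not_orP[/meets[c [k Mk]] /meets[d [l Ml]]].
  apply: (Mb (k + l)%N).
  have -> : b ^+ (k + l) = b ^+ l * (b ^+ k - c * x) +
     ((c * x) * (b ^+ l - d * y) + (c * d) * (x * y)).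
    by rewrite exprD; ring.
  by apply: (MD); [apply: (MM)|apply: (MD); apply: (MM)].
exists D, psi; split=> [|x /PM /ker //|]; last first.
  by apply/eqP => /ker Mb1; apply: (Mb 1%N); rewrite expr1.
apply: goldman_finite.
  case: fg => s gen; exists (map psi s) => S Ss Sint Sgen d.
  have [x <-] := surj d; apply: (gen (fun z => S (psi z))) => [|z|z zs].
  - case: Ss => S1 SB SM; split=> [|u v|u v]; first by rewrite rmorph1.
      by rewrite rmorphB; apply: SB.
    by rewrite rmorphM; apply: SM.
  - by rewrite rmorph_int.
  - by apply: Sgen; apply: map_f.
exists (psi b); split=> [|d d0].
  by apply/eqP => /ker Mb1; apply: (Mb 1%N); rewrite expr1.
have [x xE] := surj d; have [|c [k Mk]] := meets x.
  by move=> /ker px; rewrite -xE px eqxx in d0.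
exists (psi c), k; apply/eqP; rewrite -xE /= mulrC -rmorphM -rmorphXn eq_sym.
by rewrite -subr_eq0 -rmorphB; apply/eqP/ker.
Qed.

(** * Finitely many finite domains that detect all elements *)

(** The domains vary with the point, so a list of points is a list of such
    packages. *)
Record finite_point (R : comNzRingType) := FinitePoint {
  point_domain : idomainType;
  point_map :> {rmorphism R -> point_domain};
  point_finite : finitely_many_values (@idfun point_domain)
}.

Definition torsion_closed (R : comNzRingType) (J : set R) :=
  forall n x, (0 < n)%N -> J (x *+ n) -> J x.

Definition colon (R : comNzRingType) (J : set R) (c : R) : set R :=
  [set x | J (x * c)].

Lemma colon_ideal (R : comNzRingType) (J : set R) c :
  ideal J -> ideal (colon J c).
Proof.
case=> J0 JD JM; rewrite /colon; split=> [|x y|d x] /=; first by rewrite mul0r.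
  by rewrite mulrDl; apply: JD.
by rewrite -mulrA; apply: JM.
Qed.

Definition torsion_closure (R : comNzRingType) (J : set R) : set R :=
  [set x | exists2 n, (0 < n)%N & J (x *+ n)].

Lemma torsion_closure_ideal (R : comNzRingType) (J : set R) :
  ideal J -> ideal (torsion_closure J).
Proof.
case=> J0 JD JM; split; first by exists 1%N.
  move=> x y [n n0 Jx] [m m0 Jy]; exists (n * m)%N; first by rewrite muln_gt0 n0.
  rewrite mulrnDl mulrnA [in X in _ + X]mulnC mulrnA -mulr_natl.
  by rewrite -[X in _ + X]mulr_natl; apply: JD; apply: JM.
by move=> c x [n n0 Jx]; exists n => //; rewrite -mulrnAr; apply: JM.
Qed.

Lemma torsion_closure_closed (R : comNzRingType) (J : set R) :
  torsion_closed (torsion_closure J).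
Proof.
move=> n x n0 [m m0]; rewrite -mulrnA => Jx.
by exists (n * m)%N; rewrite // muln_gt0 n0.
Qed.

Lemma sub_torsion_closure (R : comNzRingType) (J : set R) :
  J `<=` torsion_closure J.
Proof. by move=> x Jx; exists 1%N. Qed.

(** A prime vanishes in at most one of two domains of different
    characteristics, so the same two points serve all primes. *)
Lemma two_points (R : comNzRingType) (P : set R) :
  finitely_generated_ring R -> ideal P -> (forall n, (0 < n)%N -> ~ P n%:R) ->
  exists pt1 pt2 : finite_point R,
    [/\ forall x, P x -> pt1 x = 0, forall x, P x -> pt2 x = 0
      & forall p, prime p -> p%:R != 0 :> point_domain pt1 \/
                             p%:R != 0 :> point_domain pt2].
Proof.
move=> fg idP Pn.
have avoid n : (0 < n)%N -> exists pt : finite_point R,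
    (forall x, P x -> pt x = 0) /\ n%:R != 0 :> point_domain pt.
  move=> n0; have [k|D [psi [fin psiP psin]]] := @finite_domain_avoiding R P n%:R fg idP.
    by rewrite -natrX; apply: Pn; rewrite expn_gt0 n0.
  by exists (FinitePoint psi fin); split=> //=; rewrite rmorph_nat in psin.
have [pt1 [P1 _]] := avoid 1%N isT.
have [[l [l_prime l0]]|none] := pselect (exists l, prime l /\
    l%:R = 0 :> point_domain pt1).
  have [pt2 [P2 l2]] := avoid l (prime_gt0 l_prime).
  exists pt1, pt2; split=> // p p_prime.
  have [p0|] := eqVneq (p%:R : point_domain pt1) 0; last by left.
  right; have lchar : l \in [pchar point_domain pt1].
    by rewrite inE l_prime /= l0.
  have : p \in [pchar point_domain pt1] by rewrite inE p_prime /= p0.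
  by rewrite (pcharf_eq lchar) inE => /eqP->.
exists pt1, pt1; split=> // p p_prime; left; apply/eqP => p0.
by apply: none; exists p.
Qed.

(** The prime [p] must be nonzero in the target because only such points are used
    against automorphisms of order [p]. *)
Definition detecting (R : comNzRingType) (J : set R) (L : seq (finite_point R)) :=
  forall p x, prime p -> ~ J x -> exists pt, List.In pt L /\
    p%:R != 0 :> point_domain pt /\ forall u, J (u * x) -> pt u = 0.

(** Noetherian induction on [J]. A maximal colon ideal [J : c] is the annihilator
    modulo [J] of every element of [J + (c)] outside [J], so only the points
    above this one ideal have to be added to those detecting the torsion closure
    of [J + (c)]. *)
Theorem detecting_points (R : comNzRingType) (J : set R) :
  finitely_generated_ring R -> ideal J -> torsion_closed J ->
  exists L, detecting J L.
Proof.
move=> fg; move: J; apply: noetherian_ind; first exact: noetherian_fg.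
move=> J idJ tcJ IH; have [J0 JD JM] := idJ.
have [all|] := pselect (forall x, J x); first by exists [::] => p x _ [].
move=> /existsNP[c0 Jc0].
have [P [idP [c [Jc PE]] Pmax]] := @noetherian_max R
  (fun I => exists c, ~ J c /\ I = colon J c) _ (noetherian_fg fg)
  (colon_ideal c0 idJ) (ex_intro _ c0 (conj Jc0 erefl)).
have Pn n : (0 < n)%N -> ~ P n%:R.
  by move=> n0; rewrite PE /colon /= mulr_natl => /(tcJ _ _ n0).
have [pt1 [pt2 [P1 P2 P12]]] := two_points fg idP Pn.
pose J' := torsion_closure (ideal_add J c).
have JJ' : J `<=` J'.
  by move=> x Jx; apply: sub_torsion_closure; apply: sub_ideal_add.
have [|||L LP] := IH J' _ _ JJ'.
- by apply: torsion_closure_ideal; apply: ideal_add_ideal.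
- exact: torsion_closure_closed.
- by move=> JE; apply: Jc; rewrite -JE; apply/sub_torsion_closure/ideal_add_gen.
exists [:: pt1, pt2 & L] => p x p_prime Jx.
have [[n n0 [e Jxe]]|J'x] := pselect (J' x); last first.
  have [pt [ptL [pp ptP]]] := LP p x p_prime J'x.
  by exists pt; split; [right; right|split=> // u /JJ' /ptP].
have Jec : ~ J (e * c).
  move=> Jec; apply: Jx; apply: (tcJ n) => //.
  by rewrite -(subrK (e * c) (x *+ n)); apply: JD.
(* [n * x] equals [e * c] modulo [J], so its colon ideal contains [J : c]. *)
have PE' : colon J (e * c) = P.
  apply: Pmax; [exact: colon_ideal|by exists (e * c)|].
  by rewrite PE => u; rewrite /colon /= mulrCA; apply: JM.
have PJ u : J (u * x) -> P u.
  move=> Jux; rewrite -PE' /colon /=.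
  have -> : u * (e * c) = (u * x) *+ n - u * (x *+ n - e * c).
    by rewrite -mulrnAr; ring.
  apply: idealB => //; last exact: JM.
  by rewrite -mulr_natl; apply: JM.
case: (P12 p p_prime) => pp; [exists pt1|exists pt2].
- by split; [left|split=> // u /PJ /P1].
- by split; [right; left|split=> // u /PJ /P2].
Qed.

(** * Endomorphisms of prime order that are invisible at a finite point *)

Definition hom_on (A B : pzRingType) (S : set A) (phi : A -> B) : Prop :=
  [/\ phi 1 = 1, {in S &, forall x y, phi (x - y) = phi x - phi y}
    & {in S &, forall x y, phi (x * y) = phi x * phi y}].

Section FinitePoint.
Variables (R : comNzRingType) (D : idomainType) (psi : {rmorphism R -> D}).

(** The determinant of [1 - M] annihilates every column fixed by [M]. *)
Lemma nakayama r (g : 'cV[R]_r) (M : 'M[R]_r) :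
  map_mx psi M = 0 -> M *m g = g ->
  exists u, psi u = 1 /\ u *: g = 0.
Proof.
move=> M0 Mg; exists (\det (1%:M - M)); split.
  by rewrite -det_map_mx map_mxB M0 subr0 map_mx1 det1.
rewrite -mul_scalar_mx -mul_adj_mx -mulmxA mulmxBl mul1mx Mg subrr.
exact: mulmx0.
Qed.

Section Functional.
Variables (L : set R) (x : R).
Hypotheses (idL : ideal L) (Lx : ~ L x) (kerL : forall u, psi u = 0 -> L (u * x)).
Hypothesis fin_psi : finitely_many_values psi.
Local Notation W := (ideal_add L x).

Lemma functional_unique z c d : L (z - c * x) -> L (z - d * x) -> psi c = psi d.
Proof.
move=> Lc Ld; apply/eqP; rewrite -subr_eq0 -rmorphB; apply: contrapT => /negP cd.
have [w wP] := finite_image_inverse fin_psi cd.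
apply: Lx; rewrite -[x](subrK (w * (c - d) * x)).
case: (idL) => _ LD LM; apply: LD.
  rewrite -{1}[x]mul1r -mulrBl; apply: kerL.
  by rewrite rmorphB rmorph1 rmorphM mulrC wP subrr.
rewrite -mulrA; apply: LM.
rewrite (_ : _ * _ = (z - d * x) - (z - c * x)); first exact: idealB.
by ring.
Qed.

(** As [ker psi * x] lies in [L], the coefficient [c] of [z = c * x] modulo [L]
    is well defined after applying [psi]. *)
Lemma functional_exists : exists lambda : R -> D,
  [/\ {in W &, forall z t, lambda (z + t) = lambda z + lambda t},
      forall u z, W z -> lambda (u * z) = psi u * lambda z
    & lambda x = 1].
Proof.
have [L0 LD LM] := idL.
have /choice[c cP] : forall z, exists c, W z -> L (z - c * x).
  by move=> z; have [[c Lc]|nW] := pselect (W z); [exists c|exists 0].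
have [W0 WD WM] := ideal_add_ideal x idL.
exists (psi \o c); split=> [z t /set_mem Wz /set_mem Wt|u z Wz|] /=.
- rewrite -rmorphD; apply: functional_unique (cP _ (WD _ _ Wz Wt)) _.
  by rewrite mulrDl opprD addrACA; apply: LD; apply: cP.
- rewrite -rmorphM; apply: functional_unique (cP _ (WM u _ Wz)) _.
  by rewrite -mulrA -mulrBr; apply/LM/cP.
- rewrite -(rmorph1 psi).
  apply: functional_unique (cP _ (ideal_add_gen x idL)) _.
  by rewrite mul1r subrr.
Qed.

End Functional.

(** Add the members of [gs] to [Y] one at a time: the last one that enlarges the
    ideal is [x], and [L] is the ideal just before it. *)
Lemma hyperplane (Y : set R) (gs : seq R) : ideal Y ->
  (forall x, x \in gs -> Y x) \/
  exists x L, [/\ x \in gs, ideal L, Y `<=` L, ~ L x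
                & forall z, z \in gs -> ideal_add L x z].
Proof.
elim: gs Y => [|g gs IHgs] Y idY; first by left.
have [Yg|Yg] := pselect (Y g).
  have [all|[x [L [xgs idL YL Lx LP]]]] := IHgs Y idY.
    by left=> x; rewrite inE => /predU1P[->|/all].
  right; exists x, L; split=> // [|z]; first by rewrite inE xgs orbT.
  rewrite inE => /predU1P[->|/LP//]; exact/sub_ideal_add/YL.
right; have [all|[x [L [xgs idL YL Lx LP]]]] := IHgs _ (ideal_add_ideal g idY).
  exists g, Y; split=> // [|z]; first by rewrite inE eqxx.
  by rewrite inE => /predU1P[->|/all//]; apply: ideal_add_gen.
exists x, L; split=> // [|z Yz|z]; first by rewrite inE xgs orbT.
  by apply: YL; apply: sub_ideal_add.
rewrite inE => /predU1P[->|/LP//].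
by apply/sub_ideal_add/YL/ideal_add_gen.
Qed.

(** With [C] the kernel of [psi] this is the product of that kernel with the
    ideal generated by the entries of [g]. *)
Definition combinations (C : set R) r (g : 'cV[R]_r) : set R :=
  [set z | exists c : 'rV[R]_r, (forall k, C (c ord0 k)) /\ z = (c *m g) ord0 ord0].

Lemma combinations_ideal (C : set R) r (g : 'cV[R]_r) :
  ideal C -> ideal (combinations C g).
Proof.
case=> C0 CD CM; split.
- by exists 0; split=> [k|]; rewrite ?mul0mx mxE.
- move=> _ _ [c [Cc ->]] [d [Cd ->]]; exists (c + d).
  by split=> [k|]; [rewrite mxE; apply: CD|rewrite mulmxDl [RHS]mxE].
- move=> u _ [c [Cc ->]]; exists (u *: c).
  by split=> [k|]; [rewrite mxE; apply: CM|rewrite -scalemxAl [RHS]mxE].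
Qed.

Lemma combinations_gen (C : set R) u r (g : 'cV[R]_r) k :
  ideal C -> C u -> combinations C g (u * g k ord0).
Proof.
case=> C0 _ _ Cu; exists (u *: delta_mx ord0 k); split=> [j|].
  by rewrite !mxE eqxx /=; case: eqP => _; rewrite ?mulr1 ?mulr0.
by rewrite -scalemxAl -rowE !mxE.
Qed.

Lemma kernel_ideal : ideal [set u | psi u = 0].
Proof.
split=> [|u v /= u0 v0|c u /= u0]; first exact: rmorph0.
  by rewrite rmorphD u0 v0 addr0.
by rewrite rmorphM u0 mulr0.
Qed.

Section InvisibleEndomorphism.
Variables (A : pzRingType) (s : seq A) (n : nat) (f : A -> 'M[R]_n).
Local Notation S := (subring_gen s).
Hypothesis f_hom : hom_on S f.



Variables (h : A -> A) (p : nat).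
Hypotheses (h_hom : hom_on S h) (hS : forall a, S a -> S (h a)).
Hypotheses (h_ord : forall a, S a -> iter p h a = a) (p0 : p%:R != 0 :> D).
Hypothesis fin_psi : finitely_many_values psi.

Hypothesis invisible : forall phi : A -> 'M[D]_(n + n), hom_on S phi ->
  forall a, S a -> phi (h a) = phi a.

Local Notation d a := (f (h a) - f a).

Lemma displacementM a b : S a -> S b -> d (a * b) = d a *m f (h b) + f a *m d b.
Proof.
move=> Sa Sb; case: f_hom => _ _ fM; case: h_hom => _ _ hM.
rewrite hM ?fM; try by apply/mem_set; rewrite //; apply: hS.
by rewrite mulmxBl mulmxBr addrA subrK.
Qed.

Lemma displacementB a b : S a -> S b -> d (a - b) = d a - d b.
Proof.
move=> Sa Sb; case: f_hom => _ fB _; case: h_hom => _ hB _.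
rewrite hB ?fB; try by apply/mem_set; rewrite //; apply: hS.
by rewrite !opprD !opprK addrACA.
Qed.

Definition displacements : seq R :=
  [seq (d t.1.1) t.1.2 t.2 |
     t <- allpairs pair (allpairs pair s (enum 'I_n)) (enum 'I_n)].

(** The displacement is a twisted derivation, so its values lie in the ideal
    generated by its values at the generators. *)
Lemma displacement_ideal (X : set R) : ideal X ->
  (forall z, z \in displacements -> X z) -> forall a, S a -> forall i j, X (d a i j).
Proof.
move=> idX Xgen; have [X0 XD XM] := idX.
have XS (I : finType) (F : I -> R) : (forall i, X (F i)) -> X (\sum_i F i).
  by move=> XF; apply: (big_ind X).
have [S1 SB SM] := generated_subring s.
suff sub : S `<=` [set a | S a /\ forall i j, X (d a i j)].
  by move=> a /sub[].
apply: smallest_sub => [|a /= sa]; last first.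
  split=> [T [_]|i j]; first exact.
  apply: Xgen; apply/mapP; exists (a, i, j) => //.
  by rewrite allpairs_f ?allpairs_f ?mem_enum.
split=> [|a b [Sa Xa] [Sb Xb]|a b [Sa Xa] [Sb Xb]].
- split=> // i j; case: f_hom => f1 _ _; case: h_hom => h1 _ _.
  by rewrite h1 subrr mxE.
- split=> [|i j]; first exact: SB.
  have -> : d (a - b) i j = d a i j - d b i j.
    by rewrite displacementB // mxE [X in _ + X]mxE.
  exact: idealB.
- split=> [|i j]; first exact: SM.
  rewrite displacementM // mxE; apply: XD; rewrite mxE;  apply: XS => k.
    by rewrite mulrC; apply: XM.
  exact: XM.
Qed.

(** The representation is doubled because [invisible] speaks of dimension [2n]. *)
Lemma psi_displacement a : S a -> map_mx psi (d a) = 0.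
Proof.
move=> Sa; case: f_hom => f1 fB fM.
pose phi b := block_mx (map_mx psi (f b)) 0 0 (map_mx psi (f b)).
have phi_hom : hom_on S phi.
  split=> [|x y Sx Sy|x y Sx Sy]; rewrite /phi.
  - by rewrite f1 map_mx1 -scalar_mx_block.
  - by rewrite fB // map_mxB opp_block_mx add_block_mx !oppr0 !addr0.
  - rewrite fM // map_mxM /=; apply/esym.
    by rewrite [LHS]mulmx_block !mulmx0 !mul0mx !addr0 add0r.
have := invisible phi_hom Sa; rewrite /phi => /eq_block_mx[E _ _ _].
by rewrite map_mxB E subrr.
Qed.

(** Here [lambda] is linear over [psi] on an ideal containing all displacements,
    so [lambda \o d] is a derivation along [psi \o f]. Placed above the diagonal,
    it gives a representation of dimension [2n]; as [h] does not change it,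
    [lambda] takes on the displacement of [iter p h], which is zero, [p] times
    its value on that of [h]. *)
Lemma displacement_functional0 (W : set R) (lambda : R -> D) : ideal W ->
  (forall a, S a -> forall i j, W (d a i j)) ->
  {in W &, forall z t, lambda (z + t) = lambda z + lambda t} ->
  (forall u z, W z -> lambda (u * z) = psi u * lambda z) ->
  forall a, S a -> map_mx lambda (d a) = 0.
Proof.
move=> idW Wd lD lM; have [W0 WD WM] := idW.
have [S1 SB SM] := generated_subring s.
have l0 : lambda 0 = 0 by rewrite -(mul0r (0 : R)) lM // rmorph0 mul0r.
have lN z : W z -> lambda (- z) = - lambda z.
  by move=> Wz; rewrite -mulN1r lM // rmorphN rmorph1 mulN1r.
have lS (I : Type) (r : seq I) (F : I -> R) : (forall i, W (F i)) ->
    lambda (\sum_(i <- r) F i) = \sum_(i <- r) lambda (F i).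
  move=> WF; pose K (x : R) (y : D) := W x /\ lambda x = y.
  suff [] : K (\sum_(i <- r) F i) (\sum_(i <- r) lambda (F i)) by [].
  apply: (big_ind2 K) => [//|x1 y1 x2 y2 [Wx1 <-] [Wx2 <-]|i _].
    by split; [apply: WD|apply: lD; apply/mem_set].
  by split.
have [f1 fB fM] := f_hom; have [h1 hB hM] := h_hom.
have psi_h a : S a -> map_mx psi (f (h a)) = map_mx psi (f a).
  by move=> /psi_displacement; rewrite map_mxB => /eqP; rewrite subr_eq0 => /eqP.
pose delta a := map_mx lambda (d a).
have delta_hom : hom_on S
    (fun a => block_mx (map_mx psi (f a)) (delta a) 0 (map_mx psi (f a))).
  split=> [|x y /set_mem Sx /set_mem Sy|x y /set_mem Sx /set_mem Sy].
  - rewrite /delta h1 subrr f1 map_mx1; have -> : map_mx lambda 0 = 0 :> 'M_n.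
      by apply/matrixP => i j; rewrite !mxE l0.
    by rewrite -scalar_mx_block.
  - rewrite fB ?(mem_set Sx) ?(mem_set Sy) // map_mxB.
    rewrite opp_block_mx add_block_mx oppr0 addr0; congr block_mx.
    rewrite /delta displacementB //; apply/matrixP => i j; rewrite [LHS]mxE.
    have -> : (d x - d y) i j = d x i j - d y i j.
      by rewrite mxE [X in _ + X]mxE.
    rewrite [RHS]mxE [X in _ = _ + X]mxE [X in _ = X + _]mxE [X in _ = _ - X]mxE.
    have [Wx Wy] := (Wd x Sx i j, Wd y Sy i j).
    by rewrite lD ?lN //; apply/mem_set => //; rewrite -mulN1r; apply: WM.
  - rewrite fM ?(mem_set Sx) ?(mem_set Sy) // map_mxM.
    rewrite [RHS]mulmx_block !mulmx0 !mul0mx !addr0 add0r; congr block_mx.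
    rewrite /delta displacementM // [RHS]addrC -[in RHS](psi_h y) //.
    apply/matrixP => i j; rewrite [LHS]mxE.
    have W1 k : W (d x i k * f (h y) k j) by rewrite mulrC; apply/WM/Wd.
    have W2 k : W (f x i k * d y k j) by apply/WM/Wd.
    have WS (F : 'I_n -> R) : (forall k, W (F k)) -> W (\sum_k F k).
      by move=> WF; apply: (big_ind W).
    rewrite [in LHS]mxE [X in lambda (X + _)]mxE [X in lambda (_ + X)]mxE.
    rewrite lD ?lS //; try by apply/mem_set/WS.
    rewrite [RHS]mxE [X in _ = X + _]mxE [X in _ = _ + X]mxE.
    congr (_ + _); apply: eq_bigr => k _.
      rewrite mulrC lM ?[X in _ = X * _]mxE ?[X in _ = _ * X]mxE; last exact: Wd.
      by rewrite mulrC.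
    by rewrite lM ?[X in _ = X * _]mxE ?[X in _ = _ * X]mxE //; apply: Wd.
move=> a Sa; rewrite -/(delta a).
have delta_h b : S b -> delta (h b) = delta b.
  by move=> Sb; have := invisible delta_hom Sb => /eq_block_mx[].
have Sit k : S (iter k h a) by elim: k => //= k; apply: hS.
have delta_it k : delta (iter k h a) = delta a.
  by elim: k => //= k IHk; rewrite delta_h.
(* The sum telescopes to [f (iter p h a) - f a]. *)
have tele : \sum_(k < p) d (iter k h a) = 0.
  rewrite -(big_mkord xpredT (fun k => d (iter k h a))).
  have := telescope_sumr (fun k => f (iter k h a)) (leq0n p).
  by rewrite h_ord // subrr.
apply/matrixP => i j; rewrite [RHS]mxE.
have := congr1 (fun M : 'M_n => lambda (M i j)) tele.
rewrite summxE [in RHS]mxE l0 lS => [|k]; last exact: Wd.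
rewrite (eq_bigr (fun=> delta a i j)) => [|k _]; last first.
  by rewrite -(delta_it k) [RHS]mxE.
rewrite sumr_const card_ord -mulr_natl => /eqP.
by rewrite mulf_eq0 (negPf p0) => /eqP.
Qed.

(** Either some hyperplane of the displacement ideal [X] contains its multiple
    by the kernel of [psi], and a functional vanishing there would be killed by
    the previous lemma, or [X] equals that multiple and Nakayama applies. *)
Theorem invisible_displacement : exists u, psi u = 1 /\
  forall a, S a -> u *: d a = 0.
Proof.
pose g : 'cV[R]_(size displacements) := \col_k displacements`_k.
pose mX := combinations [set u | psi u = 0] g.
have idmX : ideal mX by apply: combinations_ideal; apply: kernel_ideal.
have [all|[x [L [xgs idL mXL Lx LP]]]] := hyperplane displacements idmX.
  have /choice[c cP] : forall k : 'I_(size displacements),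
      exists c : 'rV[R]_(size displacements),
      (forall j, psi (c ord0 j) = 0) /\ g k ord0 = (c *m g) ord0 ord0.
    move=> k; have [|c [c0 cE]] := all (displacements`_k); first exact: mem_nth.
    by exists c; rewrite mxE.
  pose M : 'M[R]_(size displacements) := \matrix_(k, j) c k ord0 j.
  have [||u [u1 ug]] := @nakayama _ g M.
  - by apply/matrixP => k j; rewrite !mxE; case: (cP k).
  - apply/colP => k; case: (cP k) => _ ->; rewrite !mxE.
    by apply: eq_bigr => j _; rewrite !mxE.
  exists u; split=> // a Sa; apply/matrixP => i j; rewrite mxE [RHS]mxE.
  apply: (@displacement_ideal [set z | u * z = 0]) Sa i j.
    split=> [|y z /= y0 z0|y z /= z0]; first exact: mulr0.
      by rewrite mulrDr y0 z0 addr0.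
    by rewrite mulrCA z0 mulr0.
  move=> z /(nthP 0)[k ks <-] /=.
  by have /colP/(_ (Ordinal ks)) := ug; rewrite !mxE.
have kerL u : psi u = 0 -> L (u * x).
  move=> u0; apply: mXL; case/(nthP 0): xgs => k ks <-.
  have := combinations_gen g (Ordinal ks) kernel_ideal u0.
  by rewrite mxE.
have [lambda [lD lM lx]] := functional_exists idL Lx kerL fin_psi.
have idW := ideal_add_ideal x idL.
have l0 := displacement_functional0 idW (displacement_ideal idW LP) lD lM.
case/mapP: xgs => -[[a i] j] /= /allpairsP[[[a' i'] j']] /= [].
case/allpairsP => -[a'' i''] /= [sa _ [-> ->]] _ [-> -> ->] xE.
have /matrixP/(_ i'' j') := l0 a'' (@sub_gen_smallest _ _ [set` s] a'' sa).
by rewrite mxE -xE lx mxE => /eqP; rewrite oner_eq0.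
Qed.

End InvisibleEndomorphism.
End FinitePoint.

(** * Generated subrings as rings *)

Section GeneratedSubring.
Variables (C : comNzRingType) (t : seq C).

Definition generated_pred : C -> bool :=
  fun x => `[< subring_gen t x >].

Fact generated_pred_closed : subring_closed generated_pred.
Proof.
have [S1 SB SM] := generated_subring t.
split; first exact/asboolP.
  by move=> x y /asboolP Sx /asboolP Sy; apply/asboolP; apply: SB.
by move=> x y /asboolP Sx /asboolP Sy; apply/asboolP; apply: SM.
Qed.

Definition generated_ring := {x : C | generated_pred x}.
HB.instance Definition _ := SubChoice.on generated_ring.
HB.instance Definition _ := GRing.SubChoice_isSubComNzRing.Build C
  generated_pred generated_ring generated_pred_closed.

Lemma generated_ringP : exists (C0 : comNzRingType) (v : {rmorphism C0 -> C}),
  [/\ finitely_generated_ring C0, injective v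
    & forall x, subring_gen t x -> exists u, v u = x].
Proof.
pose v : {rmorphism generated_ring -> C} := val.
exists generated_ring, v; split; [|exact: val_inj|]; last first.
  by move=> x /asboolP Sx; exists (Sub x Sx); apply: (SubK generated_ring).
exists (pmap insub t) => S Ss _ St u.
suff [w [/val_inj <-]] : [set x | exists w, v w = x /\ S w] (v u) by [].
have [S1 SB SM] := Ss.
have /asboolP := valP u; apply; split=> [|x /= xt].
  split=> [|_ _ [a [<- Sa]] [b [<- Sb]]|_ _ [a [<- Sa]] [b [<- Sb]]].
  - by exists 1; rewrite rmorph1.
  - by exists (a - b); rewrite rmorphB; split=> //; apply: SB.
  - by exists (a * b); rewrite rmorphM; split=> //; apply: SM.
have gx : generated_pred x by apply/asboolP; apply: sub_gen_smallest.
exists (Sub x gx); split; first exact: (SubK generated_ring).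
by apply: St; rewrite mem_pmap_sub.
Qed.

End GeneratedSubring.

(** * Congruence subgroups *)

Lemma prime_order_power (G : groupType) (x : G) m : (0 < m)%N ->
  (x ^+ m = 1)%g -> x <> 1%g ->
  exists p k, [/\ prime p, (x ^+ k <> 1)%g & ((x ^+ k) ^+ p = 1)%g].
Proof.
have [n] := ubnP m; elim: n m x => // n IHn m x /[1!ltnS] mn m0 xm x1.
have [m1|m1] := leqP m 1.
  by case: x1; rewrite -xm (_ : m = 1%N) ?expg1 //; apply/eqP; rewrite eqn_leq m1.
have p_prime := pdiv_prime m1.
have [xp|xp] := pselect ((x ^+ pdiv m)%g = 1%g).
  by exists (pdiv m), 1%N; rewrite expg1.
have [||||q [k [q_prime yk yq]]] := IHn (m %/ pdiv m)%N (x ^+ pdiv m)%g => //.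
- by rewrite (leq_trans _ mn) // ltn_Pdiv // prime_gt1.
- by rewrite divn_gt0 ?pdiv_gt0 // pdiv_leq.
- by rewrite -expgnA mulnC divnK // pdiv_dvd.
by exists q, (pdiv m * k)%N; rewrite expgnA.
Qed.

Lemma finite_index_code (G : groupType) (H K : set G) (T : finType) (g : G -> T) :
  Defs.subgroup K ->
  (forall x y, H x -> H y -> g x = g y -> K (x^-1 * y)%g) -> finite_index H K.
Proof.
move=> [K1 KM KV] gP.
pose r t := if pselect (exists x, H x /\ g x = t) is left ex
            then sval (cid ex) else 1%g.
apply: (sub_finite_set (B := [set [set (r t * k)%g | k in K] | t in [set: T]])).
  move=> _ [x Hx <-]; exists (g x) => //.
  rewrite /r; case: pselect => [ex|[]]; last by exists x.
  have [Hz gz] := svalP (cid ex); set z := sval _ in Hz gz *.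
  have Kzx := gP _ _ Hz Hx gz.
  apply/seteqP; split=> _ [k Kk <-].
    exists (x^-1 * z * k)%g; last by rewrite !mulgA mulgV mul1g.
    by apply: KM => //; rewrite -[(x^-1 * z)%g]invgK; apply: KV; rewrite invgM invgK.
  by exists (z^-1 * x * k)%g; [apply: KM|rewrite !mulgA mulgV mul1g].
apply: finite_image; exact: finite_finset.
Qed.

Section Congruence.
Variables (Phi : comPzRingType) (A : algType Phi) (s : seq A).
Local Notation S := (subring_gen s).
Variable H : set (algAut A).
Hypotheses (H_group : Defs.subgroup H) (HS : forall h, H h -> forall a, S a -> S (h a)).

Lemma algAut_hom (h : algAut A) (T : set A) : hom_on T h.
Proof.
case: (algAutP h) => _ hD [h1 hM] _; split=> // [x y _ _].
have h0 : h 0 = 0 by apply: (addrI (h 0)); rewrite -hD !addr0.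
have hN : h (- y) = - h y by apply: (addIr (h y)); rewrite -hD !addNr.
by rewrite hD hN.
Qed.

Lemma hom_on_eq (B : pzRingType) (phi psi : A -> B) :
  hom_on S phi -> hom_on S psi -> (forall a, a \in s -> phi a = psi a) ->
  forall a, S a -> phi a = psi a.
Proof.
move=> [p1 pB pM] [q1 qB qM] E.
have [S1 SB SM] := generated_subring s.
suff sub : S `<=` [set a | S a /\ phi a = psi a] by move=> a /sub[].
apply: smallest_sub => [|a /= sa]; last first.
  by split; [apply: sub_gen_smallest|apply: E].
split=> [|x y [Sx Ex] [Sy Ey]|x y [Sx Ex] [Sy Ey]]; first by rewrite /= p1 q1.
  by split; [apply: SB|rewrite pB ?qB ?Ex ?Ey //; apply/mem_set].
by split; [apply: SM|rewrite pM ?qM ?Ex ?Ey //; apply/mem_set].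
Qed.

Lemma hom_on_comp (B : pzRingType) (phi : A -> B) h :
  H h -> hom_on S phi -> hom_on S (phi \o h).
Proof.
move=> Hh [p1 pB pM]; have [h1 hB hM] := algAut_hom h S.
have hin x : x \in S -> h x \in S.
  by move=> /set_mem Sx; apply/mem_set; apply: HS.
split=> [|x y Sx Sy|x y Sx Sy] /=; first by rewrite h1.
  by rewrite hB // pB //; apply: hin.
by rewrite hM // pM //; apply: hin.
Qed.

Definition same_action (D : pzRingType) N (x y : algAut A) : Prop :=
  forall phi : A -> 'M[D]_N, hom_on S phi ->
  forall a, S a -> phi (x a) = phi (y a).

(** A representation is determined by the images of the generators, so there
    are finitely many of them; the code of an automorphism is its action on
    the tuples of images, completed by the identity on the tuples that come from
    no representation. *)
Lemma same_action_code (D : idomainType) N : finitely_many_values (@idfun D) ->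
  exists (T : finType) (g : algAut A -> T), forall x y, H x -> H y ->
    g x = g y -> same_action D N x y.
Proof.
case=> e eP.
pose code (M : 'M[D]_N) : {ffun 'I_N * 'I_N -> seq_sub e} :=
  [ffun ij => SeqSub (eP (M ij.1 ij.2))].
have code_inj : injective code.
  move=> M M' /ffunP E; apply/matrixP => i j.
  by have /(congr1 val) := E (i, j); rewrite !ffunE.
pose V := {ffun 'I_(size s) -> {ffun 'I_N * 'I_N -> seq_sub e}}.
pose image_of (phi : A -> 'M[D]_N) (h : A -> A) : V :=
  [ffun k : 'I_(size s) => code (phi (h s`_k))].
pose g (h : algAut A) : {ffun V -> V} := [ffun v =>
  if pselect (exists phi, hom_on S phi /\ image_of phi id = v) is left ex
  then image_of (sval (cid ex)) h else v].
exists _, g => x y Hx Hy gxy phi phi_hom.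
have on_gens (phi1 phi2 : A -> 'M[D]_N) h1 h2 : image_of phi1 h1 = image_of phi2 h2 ->
    forall a, a \in s -> phi1 (h1 a) = phi2 (h2 a).
  move=> /ffunP E a /(nthP 0)[k ks <-].
  by have := E (Ordinal ks); rewrite !ffunE => /code_inj.
have := congr1 (fun w : {ffun V -> V} => w (image_of phi id)) gxy.
rewrite !ffunE; case: pselect => [ex|[]]; last by exists phi.
have [psi_hom psiE] := svalP (cid ex); set psi := sval _ in psi_hom psiE *.
have E := hom_on_eq psi_hom phi_hom (on_gens _ _ _ _ psiE).
move=> /on_gens Exy.
apply: (hom_on_eq (hom_on_comp Hx phi_hom) (hom_on_comp Hy phi_hom)) => a sa /=.
have Sa : S a by apply: sub_gen_smallest.
by rewrite -!E ?Exy //; apply: HS.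
Qed.

Definition congruence_subgroup (R : comNzRingType) (L : seq (finite_point R)) N :
  set (algAut A) :=
  [set h | H h /\ forall pt, List.In pt L ->
    same_action (point_domain pt) N h 1%g].

Lemma congruence_subgroup_group (R : comNzRingType) (L : seq (finite_point R)) N :
  Defs.subgroup (congruence_subgroup L N).
Proof.
have [H1 HM HV] := H_group.
split=> [|x y [Hx Kx] [Hy Ky]|x [Hx Kx]]; first by split.
  split=> [|pt ptL phi phi_hom a Sa]; first exact: HM.
  by rewrite -(Ky pt ptL _ phi_hom a Sa) (Kx pt ptL _ phi_hom) //; apply: HS.
split=> [|pt ptL phi phi_hom a Sa]; first exact: HV.
rewrite -(Kx pt ptL _ phi_hom ((x^-1)%g a)); last by apply: HS => //; apply: HV.
congr phi; exact: (congr1 (fun z : algAut A => z a) (mulgV x)).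
Qed.

Lemma congruence_subgroup_index (R : comNzRingType) (L : seq (finite_point R)) N :
  finite_index H (congruence_subgroup L N).
Proof.
have [H1 HM HV] := H_group.
have [T [g gP]] : exists (T : finType) (g : algAut A -> T), forall x y,
    H x -> H y -> g x = g y -> forall pt, List.In pt L ->
    same_action (point_domain pt) N x y.
  elim: L => [|pt L [T [g gP]]]; first by exists unit, (fun=> tt) => x y _ _ _ pt [].
  have [T' [g' gP']] := same_action_code N (point_finite pt).
  exists (T * T')%type, (fun h => (g h, g' h)) => x y Hx Hy [gxy gxy'] pt'.
  by case=> [<-|]; [apply: gP'|apply: gP].
apply: (finite_index_code (g := g)); first exact: congruence_subgroup_group.
move=> x y Hx Hy gxy; split=> [|pt ptL phi phi_hom a Sa].
  by apply: HM => //; apply: HV.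
have /= <- := gP x y Hx Hy gxy pt ptL _ (hom_on_comp (HV _ Hx) phi_hom) a Sa.
congr phi; exact: (congr1 (fun z : algAut A => z a) (mulVg x)).
Qed.

End Congruence.

(** * Automorphism groups *)

(** Matrix entries of the elements of a finitely generated subring lie in the
    subring generated by the entries of the generators. The map [f0] is only
    constrained on the subring, whence [hom_on]. *)
Lemma matrix_over_generated_subring (A : pzRingType) (C : comNzRingType) n
    (f : {rmorphism A -> 'M[C]_n}) (s : seq A) :
  exists (C0 : comNzRingType) (v : {rmorphism C0 -> C}) (f0 : A -> 'M[C0]_n),
    [/\ finitely_generated_ring C0, injective v,
        hom_on (subring_gen s) f0
      & forall a, subring_gen s a -> map_mx v (f0 a) = f a].
Proof.
set S := smallest _ _.
pose t := [seq f u.1.1 u.1.2 u.2 |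
            u <- allpairs pair (allpairs pair s (enum 'I_n)) (enum 'I_n)].
have [C0 [v [fg vinj vP]]] := generated_ringP t.
have [T1 TB TM] := generated_subring t.
have [S1 SB SM] := generated_subring s.
have T0 := subring0 (generated_subring t).
have entry a : S a -> forall i j, subring_gen t (f a i j).
  move=> Sa; suff sub : S `<=` [set a | forall i j, subring_gen t (f a i j)].
    exact: sub.
  apply: smallest_sub => [|b /= sb i j]; last first.
    apply: sub_gen_smallest; apply/mapP; exists (b, i, j) => //.
    by rewrite allpairs_f ?allpairs_f ?mem_enum.
  split=> [i j|a1 a2 E1 E2 i j|a1 a2 E1 E2 i j].
  - by rewrite rmorph1 mxE; case: eqP => _; [apply: T1|apply: T0].
  - have -> : f (a1 - a2) i j = f a1 i j - f a2 i j.
      by rewrite rmorphB mxE [X in _ + X]mxE.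
    exact: TB.
  - rewrite rmorphM mxE.
    apply: (big_ind (subring_gen t)) => [//|x y Tx Ty|k _].
      exact: (subringD (generated_subring t) Tx Ty).
    exact: TM.
have /choice[f0 f0P] : forall a, exists M : 'M[C0]_n, S a -> map_mx v M = f a.
  move=> a; have [Sa|nSa] := pselect (S a); last by exists 0.
  have /choice[w wP] := fun ij : 'I_n * 'I_n => vP _ (entry a Sa ij.1 ij.2).
  exists (\matrix_(i, j) w (i, j)) => _; apply/matrixP => i j.
  by rewrite !mxE wP.
have minj : injective (map_mx v : 'M[C0]_n -> 'M[C]_n).
  move=> M M' /matrixP E; apply/matrixP => i j; apply: vinj.
  by have := E i j; rewrite !mxE.
exists C0, v, f0; split=> //.
split=> [|x y /set_mem Sx /set_mem Sy|x y /set_mem Sx /set_mem Sy]; apply: minj.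
- by rewrite f0P // rmorph1 map_mx1.
- by rewrite map_mxB !f0P ?rmorphB //; apply: SB.
- by rewrite [RHS](map_mxM v) !f0P ?rmorphM //; apply: SM.
Qed.

Section VirtuallyTorsionFree.
Variables (Phi : comPzRingType) (A : algType Phi) (s : seq A).
Local Notation S := (subring_gen s).

Lemma algAut_expg (h : algAut A) k a : (h ^+ k)%g a = iter k h a.
Proof. by elim: k a => [|k IHk] a //; rewrite expgS /= -IHk. Qed.

(** The witness is the congruence subgroup for the points that detect all
    non-torsion elements; a torsion element would have a power of prime order,
    whose displacement is torsion and hence zero. *)
Theorem virtually_torsion_free_generated (H : set (algAut A)) :
  representable A -> no_additive_torsion A -> Defs.subgroup H ->
  (forall h, H h -> forall a, S a -> S (h a)) ->
  (forall h, H h -> (forall a, S a -> h a = a) -> h = 1%g) ->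
  virtually_torsion_free H.
Proof.
move=> [C [n [f [_ finj _]]]] torA Hgroup HS faithful.
have [C0 [v [f0 [fg vinj f0_hom f0P]]]] := matrix_over_generated_subring f s.
pose J : set C0 := torsion_closure [set 0].
have idJ : ideal J.
  apply: torsion_closure_ideal; split=> [//|x y /= -> ->|c x /= ->].
    exact: addr0.
  exact: mulr0.
have [L LP] := detecting_points fg idJ (@torsion_closure_closed _ _).
pose K := congruence_subgroup s H L (n + n).
have Kgroup : Defs.subgroup K by apply: congruence_subgroup_group.
exists K; split=> //; first by move=> h [].
  exact: congruence_subgroup_index.
have prime_order h p : K h -> prime p -> (h ^+ p = 1)%g -> h = 1%g.
  move=> [Hh Kh] p_prime hp; apply: faithful => // a Sa.
  have entries i j : J ((f0 (h a) - f0 a) i j).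
    apply: contrapT => Jij.
    have [pt [ptL [pp ptP]]] := LP p _ p_prime Jij.
    have [|||u [u1 uP]] := @invisible_displacement _ _ pt _ s n f0 f0_hom h p
      (algAut_hom h S) (HS h Hh) _ pp.
    - by move=> b _; rewrite -algAut_expg hp.
    - by case: (point_finite pt) => e eP; exists e => x; apply: eP.
    - by move=> phi phi_hom b Sb; apply: (Kh pt ptL phi phi_hom b Sb).
    have u0 : pt u = 0.
      apply: ptP; exists 1%N => //=.
      by have /matrixP/(_ i j) := uP a Sa; rewrite !mxE => ->.
    by move: u1; rewrite u0 => /eqP; rewrite eq_sym oner_eq0.
  have /choice[m mP] : forall ij : 'I_n * 'I_n, exists m : nat, (0 < m)%N /\
      (f0 (h a) - f0 a) ij.1 ij.2 *+ m = 0.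
    by move=> [i j]; have [m m0 E] := entries i j; exists m.
  pose N := (\prod_ij m ij)%N.
  have N0 : (0 < N)%N by rewrite prodn_gt0 // => ij; case: (mP ij).
  apply/eqP; rewrite -subr_eq0; apply/eqP/(torA N) => //; apply: finj.
  rewrite rmorph0 rmorphMn rmorphB /= -!f0P //; last exact: HS.
  rewrite -map_mxB -raddfMn /=; apply/matrixP => i j; rewrite mxE [RHS]mxE.
  rewrite (_ : _ *+ N = 0) ?mxE ?rmorph0 //; apply/matrixP => k l.
  rewrite mulmxnE [RHS]mxE /N (bigD1 (k, l)) //= mulrnA.
  by case: (mP (k, l)) => _ /= ->; rewrite mul0rn.
move=> h m Kh m0 hm; apply: contrapT => h1.
have [K1 KM _] := Kgroup.
have KX k : K (h ^+ k)%g by elim: k => // k IHk; rewrite expgS; apply: KM.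
have [p [k [p_prime hk1 hkp]]] := prime_order_power m0 hm h1.
by apply: hk1; apply: prime_order hkp.
Qed.

End VirtuallyTorsionFree.

(** * From finitely generated algebras to finitely generated rings *)

Section FinitelyGeneratedAlgebra.
Variables (Phi : comPzRingType) (A : algType Phi) (s : seq A).
Hypothesis gen : smallest (@subalgebra Phi A) [set` s] = [set: A].

Lemma algAut_eq1 (h : algAut A) : (forall a, a \in s -> h a = a) -> h = 1%g.
Proof.
move=> hs; apply: autE => a /=.
have [_ hD [h1 hM] hZ] := algAutP h.
suff sub : [set: A] `<=` [set a | h a = a] by exact: sub.
rewrite -gen; apply: smallest_sub => //; split=> [//|k x y /= xE yE|x y /= xE yE].
  by rewrite hD hZ xE yE.
by rewrite hM xE yE.
Qed.

Definition with_scalars (w : seq Phi) : seq A := s ++ [seq k *: 1 | k <- w].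

Lemma with_scalars_sub w w' : {subset w <= w'} ->
  subring_gen (with_scalars w) `<=`
  subring_gen (with_scalars w').
Proof.
move=> sub; apply: sub_smallest2r; first exact: generated_subring.
move=> a /=; rewrite !mem_cat => /orP[->//|/mapP[k kw ->]].
by apply/orP; right; apply/(map_f (fun k => k *: 1))/sub.
Qed.

(** Each element is a noncommutative polynomial in the generators, and involves
    finitely many scalars. *)
Lemma finitely_many_scalars (ts : seq A) :
  exists w, forall a, a \in ts -> subring_gen (with_scalars w) a.
Proof.
have one a : exists w, subring_gen (with_scalars w) a.
  suff sub : [set: A] `<=` [set a | exists w, subring_gen (with_scalars w) a].
    exact: sub.
  rewrite -gen; apply: smallest_sub => [|b /= sb]; last first.
    by exists [::]; apply: sub_gen_smallest; rewrite /= mem_cat sb.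
  have sup w w' a' : subring_gen (with_scalars w) a' ->
      subring_gen (with_scalars (w ++ w')) a'.
    by apply: with_scalars_sub => k; rewrite mem_cat => ->.
  have sup' w w' a' : subring_gen (with_scalars w') a' ->
      subring_gen (with_scalars (w ++ w')) a'.
    by apply: with_scalars_sub => k; rewrite mem_cat => ->; rewrite orbT.
  split=> [|k x y [w wx] [w' wy]|x y [w wx] [w' wy]].
  - by exists [::]; case: (generated_subring (with_scalars [::])).
  - exists (k :: (w ++ w')).
    have Ts := generated_subring (with_scalars (k :: (w ++ w'))).
    have [_ _ TM] := Ts.
    have up : {subset w ++ w' <= k :: (w ++ w')} by move=> l; rewrite inE orbC => ->.
    apply: (subringD Ts); last by apply: (with_scalars_sub up); apply: sup'.
    rewrite -[x]mul1r scalerAl; apply: TM.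
      apply: sub_gen_smallest; rewrite /= mem_cat; apply/orP; right.
      exact/(map_f (fun k => k *: 1))/mem_head.
    by apply: (with_scalars_sub up); apply: sup.
  - exists (w ++ w').
    have [_ _ TM] := generated_subring (with_scalars (w ++ w')).
    by apply: TM; [apply: sup|apply: sup'].
elim: ts => [|t ts [w wP]]; first by exists [::].
have [w' w'P] := one t; exists (w' ++ w) => a; rewrite inE => /predU1P[->|/wP].
  by move: w'P; apply: with_scalars_sub => k; rewrite mem_cat => ->.
by apply: with_scalars_sub => k; rewrite mem_cat => ->; rewrite orbT.
Qed.

Lemma algAut_scalar (h : algAut A) k : h (k *: 1) = k *: 1.
Proof. by case: (algAutP h) => _ _ [h1 _] hZ; rewrite hZ h1. Qed.

Lemma algAut_preserves (h : algAut A) (t : seq A) :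
  (forall a, a \in t -> subring_gen t (h a)) ->
  forall a, subring_gen t a -> subring_gen t (h a).
Proof.
move=> ht; have [T1 TB TM] := generated_subring t.
have [h1 hB hM] := algAut_hom h [set: A].
apply: smallest_sub => [|a /= /ht//].
split=> [|x y Tx Ty|x y Tx Ty] /=; first by rewrite h1.
  by rewrite hB ?in_setT //; apply: TB.
by rewrite hM ?in_setT //; apply: TM.
Qed.

End FinitelyGeneratedAlgebra.

Lemma generated_subgroup (G : groupType) (t : set G) :
  Defs.subgroup (smallest (@Defs.subgroup G) t).
Proof.
split=> [T [[]]//|x y Kx Ky T [Tg tT]|x Kx T [Tg tT]].
  by case: (Tg) => _ TM _; apply: TM; [apply: Kx|apply: Ky].
by case: (Tg) => _ _ TV; apply: TV; apply: Kx.
Qed.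

Theorem theorem1p7 :
  (forall (Phi : comPzRingType) (A : algType Phi),
     finitely_generated_algebra A -> PI_algebra A -> representable A ->
     no_additive_torsion A ->
     forall H : set (algAut A),
       finitely_generated_subgroup H -> virtually_torsion_free H)
  /\
  (forall A : algType int,
     finitely_generated_algebra A -> PI_algebra A -> representable A ->
     no_additive_torsion A ->
     virtually_torsion_free [set: algAut A]).
Proof.
split=> [Phi A [s gen] _ repA torA H [hs ->]|A [s gen] _ repA torA].
  pose ts := [seq (h : algAut A) a | h <- hs ++ [seq h^-1%g | h <- hs], a <- s].
  have [w wP] := finitely_many_scalars gen ts.
  have preserved (h : algAut A) : h \in hs ++ [seq h^-1%g | h <- hs] -> forall a,
      subring_gen (with_scalars s w) a ->
      subring_gen (with_scalars s w) (h a).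
    move=> hin; apply: algAut_preserves => a; rewrite mem_cat.
    case/orP=> [sa|/mapP[k kw ->]].
      by apply: wP; apply/allpairsP; exists (h, a).
    rewrite algAut_scalar; apply: sub_gen_smallest.
    by rewrite /= mem_cat; apply/orP; right; apply/(map_f (fun k => k *: 1)).
  apply: (@virtually_torsion_free_generated _ _ (with_scalars s w)) => //.
  - exact: generated_subgroup.
  - pose K := [set h : algAut A | (forall a,
        subring_gen (with_scalars s w) a ->
        subring_gen (with_scalars s w) (h a)) /\
      (forall a, subring_gen (with_scalars s w) a ->
        subring_gen (with_scalars s w) ((h^-1)%g a))].
    suff sub : smallest (@Defs.subgroup _) [set` hs] `<=` K by move=> h /sub[].
    apply: smallest_sub => [|h /= hin]; last first.
      split; apply: preserved; rewrite mem_cat ?hin //.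
      by apply/orP; right; apply: map_f.
    split=> [|x y [xS xS'] [yS yS']|x [xS xS']].
    + by split=> a Sa //; rewrite invg1.
    + by split=> a Sa; [apply: xS; apply: yS|rewrite invgM; apply: yS'; apply: xS'].
    + by split=> a Sa; [apply: xS'|rewrite invgK; apply: xS].
  - move=> h _ hfix; apply: (algAut_eq1 gen) => a sa.
    by apply: hfix; apply: sub_gen_smallest; rewrite /= mem_cat sa.
have all a : subring_gen s a.
  have [S1 SB SM] := generated_subring s.
  have S0 := subring0 (generated_subring s).
  suff sub : [set: A] `<=` subring_gen s by exact: sub.
  rewrite -gen; apply: smallest_sub => //; split=> // k x y Sx Sy.
  apply: (subringD (generated_subring s)) => //.
  have SN n : subring_gen s (x *+ n).
    elim: n => [//|n IHn]; rewrite mulrS.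
    exact: (subringD (generated_subring s)).
  rewrite -[k]intz scaler_int.
  case: k => n; first exact: SN.
  by rewrite NegzE mulrNz; apply: (subringN (generated_subring s)); apply: SN.
apply: (@virtually_torsion_free_generated _ _ s) => // h _ hfix.
by apply: autE => a; apply: hfix.
Qed.
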